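(* Let $d=2$, and assume that $\sup_{t}V''(t)\le 1$ and $\liminf_{|t|\uparrow\infty}\frac{\log V(t)}{\log|t|}>1$. Assume that the random fields $\eta_i$ have an i.i.d. Gaussian distribution with mean zero and strictly positive variance of arbitrary size. Then, with the same constant $a$ as in the overlap bound recalled in the context, $$\liminf_{L\uparrow\infty}\frac{1}{L^2\log L}\sum_{i\in\Lambda_L}\mathbb{E}\Bigl(\mu_{\varepsilon,\Lambda_L}[\eta](\phi_i^2)-\mu_{\varepsilon,\Lambda_L}[\eta](\phi_i)^2\Bigr)\ \ge\ a\ >0$$ for any $0\le\varepsilon<\infty$.
   Context: $V:\mathbb{R}\to\mathbb{R}$ is a pair potential. For a finite set $\Lambda\subset\mathbb{Z}^d$, $\varepsilon\ge 0$, and a fixed configuration $\eta=(\eta_i)_{i\in\mathbb{Z}^d}$ of real external fields, $\mu_{\varepsilon,\Lambda}[\eta]$ is the quenched finite-volume Gibbs measure with zero boundary condition, i.e. the probability measure for the variables $\phi_\Lambda=(\phi_i)_{i\in\Lambda}\in\mathbb{R}^\Lambda$ given by $$\mu_{\varepsilon,\Lambda}[\eta](d\phi_\Lambda)=\frac{1}{Z_{\varepsilon,\Lambda}[\eta]}\exp\Bigl(-\frac1{4d}\sum_{\langle i,j\rangle\in\Lambda}V(\phi_i-\phi_j)-\frac1{4d}\sum_{i\in\Lambda,\,j\in\Lambda^c,\,|i-j|=1}V(\phi_i)+\sum_{i\in\Lambda}\eta_i\phi_i\Bigr)\prod_{i\in\Lambda}\bigl(d\phi_i+\varepsilon\,\delta_0(d\phi_i)\bigr),$$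 where the first sum runs over nearest-neighbor pairs in $\Lambda$, $\Lambda^c=\mathbb{Z}^d\setminus\Lambda$, $d\phi_i$ is Lebesgue measure, $\delta_0$ is the Dirac measure at $0$, and $Z_{\varepsilon,\Lambda}[\eta]$ is the normalizing constant (partition function). $\mu_{\varepsilon,\Lambda}[\eta](f)$ denotes the expectation of $f$ under this measure. $\Lambda_L$ is the square of sidelength $2L+1$ in $\mathbb{Z}^2$ centered at the origin. $\mathbb{E}$ is the expectation over the random fields $\eta$. The constant $a$: it is known that, for $d=2$ and $V$ as in the claim, there is a constant $a>0$, independent of the distribution of the random fields and of $\varepsilon\ge0$, such that for symmetrically distributed i.i.d. $\eta_i$ with finite second moment the overlap bound $\liminf_{L\uparrow\infty}\frac{1}{L^2\log L}\sum_{i\in\Lambda_L}\mathbb{E}\bigl(\eta_i\,\mu_{\varepsilon,\Lambda_L}[\eta](\phi_i)\bigr)\ge a\,\mathbb{E}(\eta_0^2)$ holds; the $a$ in the claim is this constant. *)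

(* Defs.v *)
From HB Require Import structures.
From mathcomp Require Import all_boot all_order all_algebra finmap.
From mathcomp Require Import all_classical all_reals all_analysis.

Set Implicit Arguments.
Unset Strict Implicit.
Unset Printing Implicit Defensive.

Import Order.TTheory GRing.Theory Num.Theory.
Import numFieldNormedType.Exports.

Local Open Scope classical_set_scope.
Local Open Scope ring_scope.

Section product_measure.
Context (R : realType) (nu : {sigma_finite_measure set (measurableTypeR R) -> \bar R}).

Definition tuple_cons n (x : measurableTypeR R * n.-tuple (measurableTypeR R)) :
  n.+1.-tuple (measurableTypeR R) := [tuple of x.1 :: x.2].

Lemma measurable_tuple_cons n : measurable_fun [set: _] (@tuple_cons n).
Proof. exact: measurable_cons. Qed.

Section cons_measure.
Context (n : nat) (m : {measure set (n.-tuple (measurableTypeR R)) -> \bar R}).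

Definition cons_measure : set (n.+1.-tuple (measurableTypeR R)) -> \bar R :=
  pushforward (nu \x^ m)%E (@tuple_cons n).

Lemma cons_measure0 : cons_measure set0 = 0%E.
Proof. by rewrite /cons_measure /pushforward preimage_set0 measure0. Qed.

Lemma cons_measure_ge0 A : (0 <= cons_measure A)%E.
Proof. by rewrite /cons_measure /pushforward measure_ge0. Qed.

Lemma cons_measure_sigma_additive : semi_sigma_additive cons_measure.
Proof.
have mcons A : measurable A -> measurable (@tuple_cons n @^-1` A).
  by move=> mA; rewrite -[X in measurable X]setTI; exact: measurable_tuple_cons.
move=> F mF tF mUF; rewrite /cons_measure /pushforward preimage_bigcup.
apply: measure_semi_sigma_additive; first by move=> k; exact: mcons.
- apply/trivIsetP => /= i j _ _ ij; rewrite -preimage_setI.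
  by move/trivIsetP : tF => /(_ _ _ _ _ ij) ->//; rewrite preimage_set0.
- by rewrite -preimage_bigcup; exact: mcons.
Qed.

HB.instance Definition _ := isMeasure.Build _ _ _ cons_measure
  cons_measure0 cons_measure_ge0 cons_measure_sigma_additive.

End cons_measure.

Fixpoint tuple_product n : {measure set (n.-tuple (measurableTypeR R)) -> \bar R} :=
  if n is n'.+1
  then cons_measure (tuple_product n')
  else dirac [tuple].

End product_measure.

Section single_site.
Context (R : realType) (eps : {nonneg R}).

Definition single_site : set (measurableTypeR R) -> \bar R :=
  measure_add (@lebesgue_measure R) (mscale eps (dirac (0 : measurableTypeR R))).

HB.instance Definition _ := Measure.on single_site.

Lemma single_site_sigma_finite : sigma_finite [set: _] single_site.
Proof.
have /sigma_finiteP[F [FT _ Foo]] := sigma_finiteT (@lebesgue_measure R).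
exists F => // k; have [mF Fk] := Foo k; split=> //.
rewrite /single_site measure_addE lte_add_pinfty// /mscale.
by rewrite lte_mul_pinfty//= (@le_lt_trans _ _ 1%E) ?ltry// probability_le1.
Qed.

HB.instance Definition _ :=
  @Measure_isSigmaFinite.Build _ _ _ single_site single_site_sigma_finite.

End single_site.

Section gibbs_measure.
Context (R : realType) (d : nat) (V : R -> R) (eps : {nonneg R}).

Local Notation site := 'rV[int]_d.

Implicit Types (L : {fset site}) (i j : site).

Definition unit_vec (k : 'I_d) : site := delta_mx 0 k.

Definition neighbors i : seq site :=
  [seq i + unit_vec k | k <- enum 'I_d] ++ [seq i - unit_vec k | k <- enum 'I_d].

(* [R^L] is the space of [#|` L|]-tuples, along the enumeration of [L]. *)
Definition config L : Type := #|` L|.-tuple (measurableTypeR R).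

HB.instance Definition _ L := Measurable.on (config L).

(* A site outside [L] has index [#|` L|] and gets the default value [0], which
   is the zero boundary condition. *)
Definition height L (phi : config L) i : R := nth 0 phi (index i (enum_fset L)).

(* Each nearest-neighbor pair of [L] is listed once, as [(i, i + unit_vec k)];
   for an even [V] the choice of orientation is irrelevant. A site of [L]
   contributes to the boundary term once for each of its neighbors outside [L]. *)
Definition log_weight L (eta : site -> R) (phi : config L) : R :=
  - (4 * d%:R)^-1 *
      (\sum_(i <- L) \sum_(k < d | i + unit_vec k \in L)
         V (height phi i - height phi (i + unit_vec k)))
  - (4 * d%:R)^-1 *
      (\sum_(i <- L) \sum_(j <- neighbors i | j \notin L) V (height phi i))
  + \sum_(i <- L) eta i * height phi i.

Definition reference_measure L : {measure set (config L) -> \bar R} :=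
  tuple_product (single_site eps) #|` L|.

Definition partition_function L (eta : site -> R) : \bar R :=
  \int[reference_measure L]_phi (expR (log_weight eta phi))%:E.

Definition gibbs L (eta : site -> R) : set (config L) -> \bar R := fun A =>
  ((fine (partition_function L eta))^-1%:E *
    \int[reference_measure L]_(phi in A) (expR (log_weight eta phi))%:E)%E.

Definition gibbs_mean L (eta : site -> R) (f : config L -> R) : R :=
  fine (\int[gibbs eta]_phi (f phi)%:E).

Definition mean_height L (eta : site -> R) i : R :=
  gibbs_mean eta (fun phi : config L => height phi i).

Definition var_height L (eta : site -> R) i : R :=
  gibbs_mean eta (fun phi : config L => height phi i ^+ 2) - mean_height L eta i ^+ 2.

End gibbs_measure.

Definition box_site (d L : nat) (f : {ffun 'I_d -> 'I_L.*2.+1}) : 'rV[int]_d :=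
  \row_k ((f k)%:Z - L%:Z).

Definition box (d L : nat) : {fset 'rV[int]_d} :=
  [fset box_site f | f in {: {ffun 'I_d -> 'I_L.*2.+1}}]%fset.

Section iid_fields.
Context (R : realType) (dT : measure_display) (T : measurableType dT)
  (P : probability T R) (I : choiceType).

Definition mutually_independent (eta : I -> {RV P >-> R}) : Prop :=
  forall (J : {fset I}) (A : I -> set R), (forall i, measurable (A i)) ->
    P (\bigcap_(i in [set` J]) (eta i @^-1` A i)) =
    (\prod_(i <- J) P (eta i @^-1` A i))%E.

Definition iid (eta : I -> {RV P >-> R}) (Q : set R -> \bar R) : Prop :=
  mutually_independent eta /\
  forall i (A : set R), measurable A -> distribution P (eta i) A = Q A.

End iid_fields.

Definition symmetric_law (R : realType) (Q : set R -> \bar R) : Prop :=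
  forall A : set R, measurable A -> Q (-%R @^-1` A) = Q A.

Definition abs_infinity (R : realType) : set_system R :=
  filter_from [set: R] (fun M => [set t | M < `|t|]).

(* Since [ln x = 0] for [x <= 0], the last clause forces [V] to be eventually
   positive, as the logarithm requires. *)
Definition admissible_potential (R : realType) (V : R -> R) : Prop :=
  [/\ forall t, derivable V t 1,
      forall t, derivable V^`()%classic t 1,
      forall t, V^`(2)%classic t <= 1 &
      (1 < limf_einf (fun t : R => (ln (V t) / ln `|t|)%:E) (@abs_infinity R))%E].

Definition log_rate (R : realType) (L : nat) : R := (L%:R ^+ 2 * ln L%:R)^-1.

(* The integrability premise concerns fields with only two moments: if [V] grows
   slowly, [eta_i * mu[eta](phi_i)] may then have infinite positive and negative
   parts, so that its expectation is undefined. *)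
Definition overlap_constant (R : realType) (V : R -> R) (a : R) : Prop :=
  0 < a /\
  forall (dT : measure_display) (T : measurableType dT) (P : probability T R)
    (eta : 'rV[int]_2 -> {RV P >-> R}) (Q : set R -> \bar R) (eps : {nonneg R}),
  let second_moment := 'E_P[fun w => (eta 0%R w ^+ 2)%R]%E in
  let overlap L i := fun w : T => eta i w * mean_height V eps (box 2 L) (eta ^~ w) i in
  iid eta Q -> symmetric_law Q -> (second_moment < +oo)%E ->
  (forall L i, i \in box 2 L -> P.-integrable [set: T] (EFin \o overlap L i)) ->
  (a%:E * second_moment <=
   limn_einf (fun L => (log_rate R L)%:E * \sum_(i <- box 2 L) 'E_P[overlap L i]))%E.

(* Main.v *)
Require Import Defs.
From HB Require Import structures.
From mathcomp Require Import all_boot all_order all_algebra finmap.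
From mathcomp Require Import all_classical all_reals all_analysis.
From mathcomp Require Import measurable_realfun ring lra zify.
Import Order.TTheory GRing.Theory Num.Theory.
Import numFieldNormedType.Exports.
Local Open Scope classical_set_scope.
Local Open Scope ring_scope.

(* Gaussian integration by parts. For fixed other fields, the map
   [t |-> mu[eta_i = t](phi_i)] is smooth with derivative the variance of
   [phi_i], so [E(eta_i mu(phi_i)) = sigma^2 E(Var phi_i)]: the overlap bound
   divided by [sigma^2] is the claim. The growth of [V] enters in two ways. Since
   every site is joined to the complement of the box by a path, on which the heights
   vanish, the energy dominates every multiple of [sum_i |phi_i|], so the Gibbs
   measure has all exponential moments; and as [V] grows like a power larger
   than one, the error in this domination is polynomial in the fields, so
   [mu(phi_i)] is polynomially bounded and the overlap is integrable. *)

Set Implicit Arguments.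
Unset Strict Implicit.
Unset Printing Implicit Defensive.

(** * Product measures on tuples *)

(** The delicate point is the integrability of [eta_i * mu(phi_i)]. Dividing a pointwise bound on
    the weight by a lower bound on the partition function [Z] leaves the exponential of a polynomial
    in the fields, possibly of degree above 2, which a Gaussian does not integrate. Instead, with
    [S] the sum of all [|phi_j|], one uses [S <= K + expR (S - K)] for a [K] polynomial in the
    fields: the first term contributes [K] to the mean, and [K] is large enough for the second to
    contribute only a constant. The resulting bound is then relaxed to a multiple of [expR H], where
    [H] is the sum of the absolute fields; this is simple to handle and still integrable for normal
    fields. Integration by parts acts on one real variable, so independence is needed in the form of
    a product law for the pair made of [eta_i] and the tuple of the other fields. Exchanging the
    integrals is Fubini for the overlap, by that integrability, but Tonelli for the variance, which
    is nonnegative. The finiteness of the expected variance is thus a result and never an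
    assumption. *)

Section sigma_finite_pack_def.
Context d (T : measurableType d) (R : realType) (m : {measure set T -> \bar R}).

(* The proof is an argument, so that a canonical structure can be built from it. *)
Definition sigma_finite_pack of sigma_finite [set: T] m : set T -> \bar R := m.

Variable msf : sigma_finite [set: T] m.

HB.instance Definition _ := Measure.on (sigma_finite_pack msf).
HB.instance Definition _ :=
  @Measure_isSigmaFinite.Build _ _ _ (sigma_finite_pack msf) msf.

End sigma_finite_pack_def.

Section tuple_product_theory.
Local Open Scope ereal_scope.
Context (R : realType) (nu : {sigma_finite_measure set (measurableTypeR R) -> \bar R}).

Definition tuple_uncons n (t : n.+1.-tuple (measurableTypeR R)) :
  measurableTypeR R * n.-tuple (measurableTypeR R) := (thead t, [tuple of behead t]).

Lemma tuple_consK n : cancel (@tuple_cons R n) (@tuple_uncons n).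
Proof.
by move=> [x t]; rewrite /tuple_uncons theadE; congr pair; apply: val_inj.
Qed.

Lemma measurable_tuple_uncons n : measurable_fun [set: _] (@tuple_uncons n).
Proof.
apply/measurable_fun_pairP; split => /=; first exact: (@measurable_tnth _ _ _ ord0).
exact: measurable_behead.
Qed.

Section cons.
Variables (n : nat) (m : {sigma_finite_measure set (n.-tuple (measurableTypeR R)) -> \bar R}).

(** [cons_measure] is built on [\x^], which asks sigma-finiteness of [nu] only and so permits the
    recursion on the length. Once the tail [m] is sigma-finite as well, uniqueness of the product
    measure identifies it with [\x], for which Tonelli is applied. *)
Lemma cons_measure_prod A : measurable A ->
  cons_measure nu m A = pushforward (nu \x m) (@tuple_cons R n) A.
Proof.
move=> mA; rewrite /cons_measure /pushforward; apply/esym.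
apply: product_measure_unique.
  by move=> B C mB mC; rewrite /= product_measure2E.
by rewrite -[X in measurable X]setTI; exact: measurable_tuple_cons.
Qed.

Lemma integral_cons_measure (f : n.+1.-tuple (measurableTypeR R) -> \bar R) :
  measurable_fun [set: n.+1.-tuple (measurableTypeR R)] f -> (forall t, 0 <= f t) ->
  \int[cons_measure nu m]_t f t = \int[m]_t \int[nu]_x f (tuple_cons (x, t)).
Proof.
move=> mf f0.
have mc := @measurable_tuple_cons R n.
rewrite (eq_measure_integral (pushforward (nu \x m) (@tuple_cons R n))); last first.
  by move=> A mA _; exact: cons_measure_prod.
rewrite ge0_integral_pushforward//=.
rewrite preimage_setT fubini_tonelli2//=.
by apply: measurableT_comp => //; exact: measurable_tuple_cons.
Qed.

Lemma cons_measure_sigma_finite : sigma_finite setT (cons_measure nu m).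
Proof.
have /sigma_finiteP[F [FT ndF Foo]] := sigma_finiteT nu.
have /sigma_finiteP[G [GT ndG Goo]] := sigma_finiteT m.
exists (fun k => @tuple_uncons n @^-1` (F k `*` G k)).
  apply/esym; rewrite -preimage_bigcup -subTset => t _.
  have [i _ Fi] : (\bigcup_k F k) (thead t) by rewrite -FT.
  have [j _ Gj] : (\bigcup_k G k) [tuple of behead t] by rewrite -GT.
  exists (maxn i j) => //; split.
    by move: Fi; exact/subsetPset/ndF/leq_maxl.
  by move: Gj; exact/subsetPset/ndG/leq_maxr.
move=> k; have [mF Fk] := Foo k; have [mG Gk] := Goo k; split.
  rewrite -[X in measurable X]setTI; apply: measurable_tuple_uncons => //.
  exact: measurableX.
rewrite /cons_measure /pushforward (_ : _ @^-1` _ = F k `*` G k).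
  by rewrite product_measure2E// lte_mul_pinfty// ge0_fin_numE.
rewrite -comp_preimage (_ : _ \o _ = id) ?preimage_id//.
by apply/funext; exact: tuple_consK.
Qed.

End cons.

Lemma tuple_product0 : tuple_product nu 0 setT = 1.
Proof. by rewrite /= /dirac/= indicE in_setT. Qed.

Lemma tuple_product_sigma_finite n : sigma_finite setT (tuple_product nu n).
Proof.
elim: n => [|n ih /=].
  exists (fun=> setT); first by rewrite bigcup_const.
  by move=> _; split => //=; rewrite diracE in_setT ltry.
exact: (@cons_measure_sigma_finite n (sigma_finite_pack ih)).
Qed.

Lemma integral_tuple_productS n (f : n.+1.-tuple (measurableTypeR R) -> \bar R) :
  measurable_fun [set: n.+1.-tuple (measurableTypeR R)] f -> (forall t, 0 <= f t) ->
  \int[tuple_product nu n.+1]_t f t =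
  \int[tuple_product nu n]_t \int[nu]_x f (tuple_cons (x, t)).
Proof.
exact: (@integral_cons_measure n (sigma_finite_pack (tuple_product_sigma_finite n))).
Qed.

Lemma measurable_sum_norm_tuple n :
  measurable_fun [set: n.-tuple (measurableTypeR R)]
    (fun t => (\sum_(x <- t) `|x|)%R : measurableTypeR R).
Proof.
under eq_fun do rewrite big_tuple.
apply: measurable_sum => i; apply: measurableT_comp => //.
exact: measurable_tnth.
Qed.

(** The integrand factorises over the coordinates, so one coordinate can be integrated out at a
    time. [expR (- S)] is the function against which all later integrands over the reference measure
    are dominated. *)
Lemma tuple_product_exp_sum_norm n :
  \int[nu]_x (expR (- `|x|))%:E < +oo ->
  \int[tuple_product nu n]_t (expR (- \sum_(x <- t) `|x|))%:E < +oo.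
Proof.
move=> nufin.
have me k : measurable_fun [set: k.-tuple (measurableTypeR R)]
    (fun t => (expR (- \sum_(x <- t) `|x|))%:E).
  apply/measurable_EFinP; apply: measurableT_comp => //.
  apply: measurableT_comp => //; exact: measurable_sum_norm_tuple.
elim: n => [|n ih].
  rewrite /= integral_dirac//=; last exact: (me 0%N).
  by apply: lte_mul_pinfty => //; rewrite ?ltry// [leLHS]tuple_product0.
have me1 : measurable_fun [set: R] (fun x : R => (expR (- `|x|))%:E).
  by apply/measurable_EFinP; apply: measurableT_comp => //; apply: measurableT_comp.
rewrite (integral_tuple_productS (me n.+1))//; under eq_integral.
  move=> t _; under eq_integral.
    move=> x _; rewrite /= big_cons opprD expRD EFinM muleC; over.
  rewrite ge0_integralZl//.
  over.
rewrite ge0_integralZr//=; [|exact: me|by apply: integral_ge0 => ? _; rewrite lee_fin expR_ge0].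
apply: lte_mul_pinfty => //; first exact: integral_ge0.
by rewrite ge0_fin_numE//; exact: integral_ge0.
Qed.

Lemma tuple_product_gt0 n : 0 < nu setT -> 0 < tuple_product nu n setT.
Proof.
move=> nu0; elim: n => [|n ih]; first by rewrite tuple_product0 lte01.
have -> : tuple_product nu n.+1 setT = nu setT * tuple_product nu n setT.
  by rewrite /= /cons_measure /pushforward preimage_setT -setXTT product_measure2E.
exact: mule_gt0.
Qed.

End tuple_product_theory.

(** * The single-site measure: positive mass and integrability of [expR (- |x|)] *)

Section single_site_theory.
Local Open Scope ereal_scope.
Context (R : realType) (eps : {nonneg R}).

Lemma single_site_gt0 : 0 < single_site eps setT.
Proof.
rewrite /single_site measure_addE (@lt_le_trans _ _ (lebesgue_measure (setT : set R)))//.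
  by rewrite -set_itvNyy lebesgue_measure_itv/= ltry.
by rewrite leeDl.
Qed.

Lemma is_derive_opp_expRN (x : R) :
  is_derive x (1 : R)%R (fun x => - expR (- x))%R (expR (- x))%R.
Proof.
have := is_deriveN (is_derive1_comp _ _ : is_derive x 1%R (expR \o -%R) (expR (- x) * -1)%R).
by rewrite mulrN1 opprK; exact.
Qed.

Lemma integral_exp_norm : \int[lebesgue_measure]_x (expR (- `|x : R|))%:E = 2%:E.
Proof.
have cE : continuous (fun x : R => expR (- `|x|)).
  move=> x; apply: (@continuous_comp _ _ _ (fun x : R => - `|x|)%R expR).
    by apply: (@continuousN _ R^o); exact: norm_continuous.
  exact: continuous_expR.
rewrite ge0_symfun_integralT//; last by move=> x /=; rewrite normrN.
rewrite -set_itvcy -[RHS]mule1; congr *%E.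
under eq_integral.
  move=> x; rewrite inE/= in_itv/= andbT => x0; rewrite ger0_norm//; over.
rewrite (@ge0_continuous_FTC2y _ _ (fun x => - expR (- x))%R 0%R 0%R)//.
- by rewrite oppr0 expR0 sub0e EFinN oppeK.
- apply: continuous_subspaceT => x.
  apply: (@continuous_comp _ _ _ -%R expR); [exact: opp_continuous|exact: continuous_expR].
- rewrite -oppr0; apply: (@cvgN _ R^o).
  exact: cvgr_expR.
- apply: cvg_at_right_filter; apply: (@cvgN _ R^o).
  apply: (@continuous_comp _ _ _ -%R expR); [exact: opp_continuous|exact: continuous_expR].
- by move=> x _; rewrite derive1E; case: (is_derive_opp_expRN x).
Qed.

Lemma single_site_exp_norm : \int[single_site eps]_x (expR (- `|x|))%:E < +oo.
Proof.
have me1 : measurable_fun [set: R] (fun x : R => (expR (- `|x|))%:E).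
  by apply/measurable_EFinP; apply: measurableT_comp => //; apply: measurableT_comp.
rewrite /single_site ge0_integral_measure_add//=.
rewrite integral_exp_norm ge0_integral_mscale// integral_dirac//.
by rewrite normr0 oppr0 expR0 mule1 lte_add_pinfty ?ltry// lte_mul_pinfty// ?ltry.
Qed.

End single_site_theory.

(** * Growth of the potential and of the energy *)

Section potential.
Context (R : realType) (V : R -> R).

Lemma admissible_continuous : admissible_potential V -> continuous V.
Proof.
by move=> [dV _ _ _] x; apply: differentiable_continuous; exact/derivable1_diffP.
Qed.

(** The lower limit is minus an infimum of suprema of the negated ratio; being above 1 it yields one
    tail set on which the ratio stays above a fixed number greater than 1. Positivity of [V] follows
    there: [ln] is 0 at nonpositive arguments, which would make the ratio 0. *)
Lemma admissible_log_growth : admissible_potential V ->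
  exists q M : R, [/\ 1 < q, 1 < M & forall t, M <= `|t| ->
    0 < V t /\ q * ln `|t| <= ln (V t)].
Proof.
move=> [_ _ _]; rewrite /limf_einf lteNr => /ereal_inf_lt[_ [U [M _ MU] <-]] supU.
have [s [s0 sU]] : exists s : R, 1 < s /\ forall t, U t -> s <= ln (V t) / ln `|t|.
  have bnd (r : R) : (ereal_sup [set - (ln (V x) / ln `|x|)%:E | x in U] <= r%:E)%E ->
      forall t, U t -> - r <= ln (V t) / ln `|t|.
    move=> supr t Ut; rewrite lerNl -lee_fin; apply: le_trans supr.
    by apply: ereal_sup_ubound => /=; exists t.
  case E : (ereal_sup _) supU bnd => [r| |] //=.
  - rewrite lte_fin => r1 bnd; exists (- r); split; first by lra.
    exact: bnd.
  - move=> _ bnd; exists 2; split; first by lra.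
    by rewrite -[2]opprK; apply: bnd; rewrite leNye.
(* Beyond 2 the logarithm of [|t|] is positive, so the bound on the ratio can be multiplied out. *)
exists s, (Num.max M 2 + 1); split => //.
  have : 2 <= Num.max M 2 by rewrite le_max lexx orbT.
  by lra.
move=> t Mt.
have tM : M < `|t| /\ 2 < `|t|.
  have : M <= Num.max M 2 by rewrite le_max lexx.
  have : 2 <= Num.max M 2 by rewrite le_max lexx orbT.
  by lra.
have lt0 : 0 < ln `|t| by rewrite ln_gt0//; lra.
have := sU t (MU t tM.1); rewrite ler_pdivlMr// => h; split => //.
rewrite ltNge; apply/negP => /ln0 V0; move: h; rewrite V0.
have : 0 < s * ln `|t| by rewrite mulr_gt0//; lra.
lra.
Qed.

(** A Legendre-type bound. Since [V] grows at least like [|t|^q], the line [B |t|] can exceed it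
    only where [|t|] is at most polynomial in [B], and there [B |t|] is itself polynomial in [B]. It
    matters that [C] and [n] are uniform in the slope [B]. *)
Lemma admissible_growth : admissible_potential V ->
  exists (C : R) (n : nat), 0 <= C /\
    forall B t : R, 0 <= B -> B * `|t| <= V t + C * (1 + B) ^+ n.
Proof.
move=> hV; have [q [M [q1 M1 VM]]] := admissible_log_growth hV.
have cV := admissible_continuous hV.
have [D D0 VD] : exists2 D : R, 0 <= D & forall t, - D <= V t.
  have MM : - M <= M by lra.
  have [c cM Vc] := @EVT_min _ V (- M) M MM (continuous_subspaceT cV).
  exists `|V c| => // t; have [tM|Mt] := leP `|t| M.
    have := Vc t; rewrite in_itv/= -ler_norml => /(_ tM); apply: le_trans.
    by rewrite lerNl -normrN ler_norm.
  have [Vt0 _] := VM t (ltW Mt); apply: le_trans (ltW Vt0).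
  by rewrite oppr_le0.
(* An integer above [1 / (q - 1)]: then [|t| >= (1 + B)^n] forces [|t|^(q - 1) >= 1 + B], hence
   [V t >= |t|^q >= B |t|] once also [|t| >= M]. *)
pose n := (Num.truncn (q - 1)^-1).+1.
have qn : 1 <= (q - 1) * n%:R.
  rewrite mulrC -ler_pdivrMr ?subr_gt0// mul1r ltW//.
  by rewrite /n truncnS_gt.
exists (D + M), n.+1; split => [|B t B0]; first by lra.
have B1 : 1 <= 1 + B by lra.
have Bn1 : 1 <= (1 + B) ^+ n by rewrite exprn_ege1.
have Bn : (1 + B) ^+ n.+1 = (1 + B) * (1 + B) ^+ n by rewrite exprS.
have [tB|Bt] := leP `|t| (M * (1 + B) ^+ n).
  have : B * `|t| <= B * (M * (1 + B) ^+ n) by rewrite ler_wpM2l.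
  have := VD t; rewrite Bn.
  have : D * 1 <= D * ((1 + B) * (1 + B) ^+ n).
    by rewrite ler_wpM2l// -[leLHS]mul1r ler_pM.
  have : 0 <= M * (1 + B) ^+ n by rewrite mulr_ge0//; lra.
  nra.
have Mt : M <= `|t|.
  by apply: le_trans (ltW Bt); rewrite ler_peMr//; lra.
have [Vt0 lV] := VM t Mt.
have t0 : 0 < `|t| by lra.
suff : B * `|t| <= V t.
  move=> /le_trans; apply; rewrite lerDl mulr_ge0//; first by lra.
  by rewrite exprn_ge0//; lra.
apply: (@le_trans _ _ ((1 + B) * `|t|)); first by rewrite ler_wpM2r// lerDr.
rewrite -ler_ln ?posrE ?mulr_gt0//; last by lra.
apply: le_trans lV; rewrite lnM ?posrE//; last by lra.
have ltB : n%:R * ln (1 + B) <= ln `|t|.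
  rewrite mulr_natl -lnXn; last by lra.
  rewrite ler_ln ?posrE//; last by lra.
  by apply: le_trans (ltW Bt); rewrite ler_peMl//; lra.
have lB0 : 0 <= ln (1 + B) by rewrite ln_ge0.
have : (q - 1) * (n%:R * ln (1 + B)) <= (q - 1) * ln `|t|.
  by rewrite ler_wpM2l// subr_ge0 ltW.
rewrite mulrA => h; have : 1 * ln (1 + B) <= (q - 1) * n%:R * ln (1 + B).
  by rewrite ler_wpM2r.
lra.
Qed.

End potential.

(** * The energy controls the sum of the heights *)

Section log_weight_bound.
Context (R : realType) (d : nat) (V : R -> R).
Local Notation site := 'rV[int]_d.+1.
Implicit Types (L : {fset site}) (i j : site).

Lemma height_notin L (phi : config R L) i : i \notin L -> height phi i = 0.
Proof.
move=> iL; rewrite /height nth_default// size_tuple leqNgt.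
by rewrite index_mem.
Qed.

Lemma sum_height L (phi : config R L) (f : R -> R) :
  \sum_(i <- L) f (height phi i) = \sum_(x <- phi) f x.
Proof.
rewrite (big_nth 0) big_mkord [RHS](big_nth 0) big_mkord size_tuple.
by apply: eq_bigr => k _; rewrite /height index_uniq// fset_uniq.
Qed.

(** The energy of [log_weight] with a free function on the bonds. Being monotone and linear in [f],
    it carries pointwise bounds on [V] over to the energy; it is used with [V], with the norm, and
    with the constant 1, which counts bonds. *)
Definition bond_sum L (phi : config R L) (f : R -> R) : R :=
  \sum_(i <- L) \sum_(k < d.+1 | i + unit_vec k \in L)
     f (height phi i - height phi (i + unit_vec k)) +
  \sum_(i <- L) \sum_(j <- neighbors i | j \notin L) f (height phi i).

Lemma log_weight_bond_sum L eta (phi : config R L) :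
  log_weight V eta phi = - (4 * d.+1%:R)^-1 * bond_sum phi V +
    \sum_(i <- L) eta i * height phi i.
Proof. by rewrite /log_weight /bond_sum mulrDr -!mulNr. Qed.

Lemma ler_bond_sum L (phi : config R L) (f g : R -> R) : (forall x, f x <= g x) ->
  bond_sum phi f <= bond_sum phi g.
Proof.
by move=> fg; apply: lerD; apply: ler_sum => i _; apply: ler_sum => j _.
Qed.

Lemma bond_sumD L (phi : config R L) (f g : R -> R) :
  bond_sum phi (fun x => f x + g x) = bond_sum phi f + bond_sum phi g.
Proof.
rewrite /bond_sum addrACA; congr (_ + _); rewrite -big_split/=;
by apply: eq_bigr => i _; rewrite big_split.
Qed.

Lemma bond_sumZ L (phi : config R L) c (f : R -> R) :
  bond_sum phi (fun x => c * f x) = c * bond_sum phi f.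
Proof.
rewrite /bond_sum mulrDr !mulr_sumr; congr (_ + _);
by apply: eq_bigr => i _; rewrite mulr_sumr.
Qed.

Lemma bond_sum_ge0 L (phi : config R L) (f : R -> R) : (forall x, 0 <= f x) ->
  0 <= bond_sum phi f.
Proof.
by move=> f0; apply: addr_ge0; apply: sumr_ge0 => i _; apply: sumr_ge0.
Qed.

(** A step is paid for by a single term of the bond sum: an interior bond, or a boundary bond when
    the step leaves [L]. Outside [L] the height is already 0. *)
Lemma le_height_step L (phi : config R L) i k :
  `|height phi i| <= `|height phi (i + unit_vec k)| + bond_sum phi Num.norm.
Proof.
have [iL|/height_notin ->] := boolP (i \in L); last first.
  by rewrite normr0 addr_ge0// bond_sum_ge0.
have [jL|jL] := boolP (i + unit_vec k \in L).
  rewrite -[X in `|X| <= _](subrK (height phi (i + unit_vec k))).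
  apply: le_trans (ler_normD _ _) _; rewrite addrC lerD2l.
  rewrite /bond_sum (big_fsetD1 i)//= (bigD1 k)//= -!addrA lerDl.
  by rewrite !addr_ge0 ?sumr_ge0// => *; rewrite ?sumr_ge0.
rewrite (height_notin _ jL) normr0 add0r.
rewrite /bond_sum [X in _ <= _ + X](big_fsetD1 i)//=.
have kn : i + unit_vec k \in neighbors i.
  by rewrite mem_cat; apply/orP; left; apply/mapP; exists k; rewrite ?mem_enum.
rewrite (big_rem _ kn)/= jL addrCA -addrA lerDl.
by rewrite !addr_ge0 ?sumr_ge0// => *; rewrite ?sumr_ge0.
Qed.

Lemma le_height_walk L (phi : config R L) i k m :
  `|height phi i| <= `|height phi (i + unit_vec k *+ m)| + bond_sum phi Num.norm *+ m.
Proof.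
elim: m => [|m ih]; first by rewrite !mulr0n !addr0.
apply: le_trans ih _; rewrite !mulrSr (addrA i) [X in _ <= _ + X]addrC addrA lerD2r.
exact: le_height_step.
Qed.

Lemma exit_walk L : exists m, forall i, i \in L -> i + unit_vec (0 : 'I_d.+1) *+ m \notin L.
Proof.
pose B := (\sum_(i <- L) `|i ord0 ord0|)%N.
have iB i : i \in L -> (`|i ord0 ord0| <= B)%N.
  by move=> iL; rewrite /B (big_fsetD1 i)//= leq_addr.
(* Coordinates in direction 0 lie between [-B] and [B] on [L], so a shift by [2B + 1] leaves [L]
   from every starting point. *)
exists (B + B).+1 => i iL; apply/negP => /[dup] jL /iB.
rewrite !mxE mulmxnE mxE !eqxx/= -mulrnA.
have := iB _ iL; move: (i ord0 ord0) => x xB.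
lia. Qed.

(** A Poincaré-type inequality for zero boundary values: along the walk out of [L] each increment is
    crudely replaced by the whole bond sum. The constant may depend on [L], since it only serves
    integrability in a fixed volume. *)
Lemma sum_norm_le_bond_sum L : exists m : nat, forall phi : config R L,
  \sum_(x <- phi) `|x| <= m%:R * bond_sum phi Num.norm.
Proof.
have [m mL] := exit_walk L; exists (m * #|` L|)%N => phi.
rewrite -(sum_height phi) big_seq.
apply: (@le_trans _ _ (\sum_(i <- L | i \in L) bond_sum phi Num.norm *+ m)).
  apply: ler_sum => i iL; apply: le_trans (le_height_walk phi i 0 m) _.
  by rewrite height_notin ?mL// normr0 add0r.
rewrite -big_seq big_const_seq count_predT iter_addr_0 -mulrnA.
by rewrite mulr_natl.
Qed.

Lemma field_term_le L (eta : site -> R) (phi : config R L) :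
  `|\sum_(i <- L) eta i * height phi i| <=
  (\sum_(i <- L) `|eta i|) * \sum_(x <- phi) `|x|.
Proof.
rewrite -(sum_height phi) mulr_suml.
apply: le_trans (ler_norm_sum _ _ _) _; rewrite !big_seq; apply: ler_sum => i iL.
rewrite normrM ler_wpM2l// -big_seq (big_fsetD1 i)//= lerDl.
by rewrite sumr_ge0.
Qed.

(** The slope [B] is free and the error is polynomial in [B] and the fields, uniformly in [phi].
    Every exponential moment of the Gibbs measure, and the growth of its means in the fields, are
    read off from this bound. *)
Lemma log_weight_le (hV : admissible_potential V) L :
  exists (C : R) (n : nat), 0 <= C /\ forall eta (phi : config R L) (B : R), 0 <= B ->
  log_weight V eta phi <=
    - (B * \sum_(x <- phi) `|x|) + C * (1 + B + \sum_(i <- L) `|eta i|) ^+ n.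
Proof.
have [C [n [C0 VC]]] := admissible_growth hV.
have [m mL] := sum_norm_le_bond_sum L.
pose c : R := 4 * d.+1%:R.
have c0 : 0 < c by rewrite mulr_gt0.
(* The number of bonds, boundary ones included. The function is constant, so the zero configuration
   is a mere placeholder. *)
pose Nb := bond_sum ([tuple 0 | _ < #|` L|] : config R L) (fun=> 1).
have Nb0 : 0 <= Nb by apply: bond_sum_ge0 => _; exact: ler01.
have K0 : 0 <= c * m%:R by rewrite mulr_ge0 ?(ltW c0).
exists (c^-1 * (C * (1 + c * m%:R) ^+ n * Nb)), n; split.
  rewrite mulr_ge0 ?invr_ge0 ?(ltW c0)// mulr_ge0// mulr_ge0// exprn_ge0//; lra.
move=> eta phi B B0; rewrite log_weight_bond_sum -/c.
set S := \sum_(x <- phi) `|x|; set H := \sum_(i <- L) `|eta i|.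
have S0 : 0 <= S by apply: sumr_ge0.
have H0 : 0 <= H by apply: sumr_ge0.
(* The slope on each bond: [c] undoes the prefactor of the energy and [m] the constant of
   [sum_norm_le_bond_sum], so that [(B + H) S] is gained. The part [H S] absorbs the field term, and
   [B S] remains. *)
pose B' := c * m%:R * (B + H).
have B'0 : 0 <= B' by rewrite mulr_ge0 ?addr_ge0.
have bondV : B' * bond_sum phi Num.norm <= bond_sum phi V + C * (1 + B') ^+ n * Nb.
  rewrite (_ : Nb = bond_sum phi (fun=> 1))// -!bond_sumZ -bond_sumD.
  by apply: ler_bond_sum => x; rewrite mulr1; exact: VC.
have BS : (B + H) * S <= c^-1 * (B' * bond_sum phi Num.norm).
  have -> : c^-1 * (B' * bond_sum phi Num.norm) = (B + H) * (m%:R * bond_sum phi Num.norm).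
    by rewrite /B'; move: c0 => /gt_eqF/negbT; move: (c) => x x0; field.
  by rewrite ler_wpM2l ?addr_ge0//; exact: mL.
have Bn : (1 + B') ^+ n <= (1 + c * m%:R) ^+ n * (1 + B + H) ^+ n.
  rewrite -exprMn lerXn2r// ?nnegrE ?mulr_ge0 ?addr_ge0// /B'.
  by nra.
have := field_term_le eta phi; rewrite -/S -/H => /(le_trans (ler_norm _)) eS.
have : c^-1 * (B' * bond_sum phi Num.norm) <=
       c^-1 * (bond_sum phi V + C * (1 + B') ^+ n * Nb).
  by rewrite ler_wpM2l// invr_ge0 ltW.
have : c^-1 * (C * (1 + B') ^+ n * Nb) <= 
  c^-1 * (C * (1 + c * m%:R) ^+ n * Nb) * (1 + B + H) ^+ n.
  rewrite -[leRHS]mulrA ler_wpM2l ?invr_ge0 ?(ltW c0)// [leRHS]mulrAC ler_wpM2r//.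
  by rewrite -mulrA ler_wpM2l.
lra.
Qed.

End log_weight_bound.

(** * Integration against a density *)

Section density.
Local Open Scope ereal_scope.
Context d (X : measurableType d) (R : realType).
Variables (m nu : {measure set X -> \bar R}) (g : X -> R).
Hypotheses (mg : measurable_fun [set: X] g) (g0 : forall x, (0 <= g x)%R).
Hypothesis nuE : forall A, measurable A -> nu A = \int[m]_(x in A) (g x)%:E.

Import HBNNSimple.

Let mgE : measurable_fun [set: X] (EFin \o g).
Proof. exact/measurable_EFinP. Qed.

Lemma nnsfun_integral_density (h : {nnsfun X >-> R}) :
  \int[nu]_x (h x)%:E = \int[m]_x ((h x)%:E * (g x)%:E).
Proof.
rewrite integralT_nnsfun sintegralE.
have -> : \int[m]_x ((h x)%:E * (g x)%:E) =
    \int[m]_x (\sum_(y \in range h) (y * \1_(h @^-1` [set y]) x)%:E * (g x)%:E).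
  apply: eq_integral => x _; rewrite -ge0_mule_fsuml => [|y]; last first.
    exact: nnfun_muleindic_ge0.
  by rewrite fsumEFin// -(fimfunE _ x).
rewrite ge0_integral_fsum//; last 2 first.
- move=> y; apply: emeasurable_funM => //; apply/measurable_EFinP.
  exact: measurable_funM.
- move=> y x _; apply: mule_ge0; last by rewrite lee_fin.
  by rewrite EFinM; exact: nnfun_muleindic_ge0.
apply: eq_fsbigr => y /set_mem [x _ hx].
have y0 : (0 <= y)%R by rewrite -hx.
under [RHS]eq_integral do rewrite EFinM -muleA.
rewrite ge0_integralZl//; last 2 first.
- by apply: emeasurable_funM => //; apply/measurable_EFinP.
- by move=> z _; rewrite mule_ge0 ?lee_fin.
have mhy : measurable (h @^-1` [set y]) by exact: (measurable_funPTI h).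
congr *%E; rewrite nuE//.
rewrite integral_mkcond; apply: eq_integral => z _.
by rewrite patchE indicE; case: ifPn; rewrite ?mul1e ?mul0e.
Qed.

Lemma ge0_integral_density (f : X -> \bar R) : measurable_fun [set: X] f ->
  (forall x, 0 <= f x) -> \int[nu]_x f x = \int[m]_x (f x * (g x)%:E).
Proof.
move=> mf f0; pose h := nnsfun_approx measurableT mf.
have hf x : (h n x)%:E @[n --> \oo] --> f x by exact: cvg_nnsfun_approx.
transitivity (limn (fun n => \int[nu]_x (h n x)%:E)).
  rewrite -monotone_convergence//.
  - by apply: eq_integral => x _; apply/esym/cvg_lim.
  - by move=> n; apply/measurable_EFinP.
  - by move=> n x _; rewrite lee_fin.
  - by move=> x _ a b ab; rewrite lee_fin; exact/lefP/nd_nnsfun_approx.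
rewrite (_ : (fun n => _) = fun n => \int[m]_x ((h n x)%:E * (g x)%:E)); last first.
  by apply/funext => n; exact: nnsfun_integral_density.
rewrite -monotone_convergence//.
- apply: eq_integral => x _; apply/cvg_lim => //.
  by apply: cvgeZr => //; exact: hf.
- by move=> n; apply: emeasurable_funM => //; apply/measurable_EFinP.
- by move=> n x _; rewrite mule_ge0 ?lee_fin.
- move=> x _ a b ab; rewrite lee_wpmul2r ?lee_fin//; exact/lefP/nd_nnsfun_approx.
Qed.

(** No integrability is required: multiplication by the nonnegative [g] commutes with taking
    positive and negative parts. It is applied to the normal law and to the Gibbs measure. *)
Lemma integral_density (f : X -> \bar R) : measurable_fun [set: X] f ->
  \int[nu]_x f x = \int[m]_x (f x * (g x)%:E).
Proof.
move=> mf; rewrite integralE [RHS]integralE.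
rewrite !ge0_integral_density//; last 2 first.
- exact: measurable_funeneg.
- exact: measurable_funepos.
congr (_ - _); apply: eq_integral => x _; rewrite ?funeposE ?funenegE.
  by rewrite maxeMl ?lee_fin// mul0e.
by rewrite -mulNe maxeMl ?lee_fin// mul0e.
Qed.

End density.

(** * Differentiation of exponential families *)

Section exponential_family.
Context d (X : measurableType d) (R : realType).
Variables (m : {measure set X -> \bar R}) (h w : X -> R).
Hypotheses (mh : measurable_fun [set: X] h) (mw : measurable_fun [set: X] w).
Hypothesis w0 : forall x, 0 <= w x.
Hypothesis exp_int : forall B : R,
  m.-integrable [set: X] (fun x => (expR (B * `|h x|) * w x)%:E).

(** In the application [t] is the field at one site, [h] the height there and [w] the weight with
    that field set to 0. Order 0 is then the partition function, and differentiating in [t] raises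
    the order by one. *)
Definition exp_moment k t : R := \int[m]_x (h x ^+ k * expR (t * h x) * w x).

Lemma ler_expr_expR (x : R) k : `|x ^+ k| <= expR (k%:R * `|x|).
Proof.
rewrite normrX expRM_natl lerXn2r ?nnegrE ?expR_ge0//.
by apply: le_trans (expR_ge1Dx _); rewrite lerDr.
Qed.

Lemma exp_moment_bound k t x (B : R) : `|t| <= B ->
  `|h x ^+ k * expR (t * h x) * w x| <= expR ((k%:R + B) * `|h x|) * w x.
Proof.
move=> tB; rewrite !normrM (ger0_norm (w0 x)) ler_wpM2r// mulrDl expRD.
rewrite ler_pM ?normr_ge0 ?ler_expr_expR// (ger0_norm (expR_ge0 _)) ler_expR.
by apply: le_trans (ler_norm _) _; rewrite normrM ler_wpM2r.
Qed.

Lemma measurable_exp_moment k t :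
  measurable_fun [set: X] (fun x => h x ^+ k * expR (t * h x) * w x).
Proof.
apply: measurable_funM => //; apply: measurable_funM.
  exact: measurable_funX.
by apply: measurableT_comp => //; apply: measurable_funM.
Qed.

Lemma integrable_exp_moment k t :
  m.-integrable [set: X] (fun x => (h x ^+ k * expR (t * h x) * w x)%:E).
Proof.
apply: le_integrable (exp_int (k%:R + `|t|)) => //.
  by apply/measurable_EFinP; exact: measurable_exp_moment.
move=> x _ /=; rewrite lee_fin (le_trans (exp_moment_bound _ _ (lexx _)))//.
exact: ler_norm.
Qed.

Lemma is_derive_exp_moment k (t : R) :
  is_derive t (1 : R) (exp_moment k) (exp_moment k.+1 t).
Proof.
pose f (s : R) x := h x ^+ k * expR (s * h x) * w x.
have df s x : is_derive s (1 : R) (f ^~ x) (h x ^+ k.+1 * expR (s * h x) * w x).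
  have H1 : is_derive s (1 : R) (expR \o (fun s => s * h x)) (expR (s * h x) * h x).
    apply: is_derive1_comp.
    by apply: is_derive_eq; rewrite /GRing.scale/= mulr0 add0r mulr1.
  have := is_deriveZ (h x ^+ k * w x) H1.
  rewrite (_ : _ \*: _ = f ^~ x); last first.
    by apply/funext => u; rewrite /f/= /GRing.scale/=; ring.
  by rewrite (_ : _ *: _ = h x ^+ k.+1 * expR (s * h x) * w x)// exprS /GRing.scale/=; ring.
(* Domination is only needed locally: near [t] one has [|s| <= |t| + 1], so one exponential of [|h|]
   bounds all the derivatives at once. *)
have It : `]t - 1, t + 1[%classic t by rewrite /= in_itv/=; lra.
have d1 s x : partial1of2 f s x = h x ^+ k.+1 * expR (s * h x) * w x.
  by rewrite partial1of2E; case: (df s x).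
have intf s : `]t - 1, t + 1[%classic s -> m.-integrable [set: X] (EFin \o f s).
  by move=> _; exact: integrable_exp_moment.
have derf s x : `]t - 1, t + 1[%classic s -> [set: X] x -> derivable (f ^~ x) s 1.
  by move=> _ _; case: (df s x).
have G0 x : 0 <= expR ((k.+1%:R + (`|t| + 1)) * `|h x|) * w x.
  by rewrite mulr_ge0// expR_ge0.
have Gub s x : `]t - 1, t + 1[%classic s -> [set: X] x ->
    `|partial1of2 f s x| <= expR ((k.+1%:R + (`|t| + 1)) * `|h x|) * w x.
  rewrite /= in_itv/= => /andP[s1 s2] _; rewrite d1; apply: exp_moment_bound.
  by move: s1 s2; case: (ger0P t); case: (ger0P s); lra.
have dM := derivable_under_integral measurableT It intf derf G0 (exp_int _) Gub.
have := differentiation_under_integral measurableT It intf derf G0 (exp_int _) Gub.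
rewrite derive1E => DM; apply: DeriveDef => //; rewrite DM.
by apply: eq_Rintegral => x _; exact: d1.
Qed.

Hypothesis mass_gt0 : forall t, 0 < exp_moment 0 t.

Definition tilted_mean t := exp_moment 1 t / exp_moment 0 t.
Definition tilted_var t := exp_moment 2 t / exp_moment 0 t - tilted_mean t ^+ 2.

Lemma is_derive_tilted_mean (t : R) : is_derive t (1 : R) tilted_mean (tilted_var t).
Proof.
have n0 : exp_moment 0 t != 0 by rewrite gt_eqF.
have H := is_deriveM (is_derive_exp_moment 1 t) (is_deriveV n0 (is_derive_exp_moment 0 t)).
refine (is_derive_eq (H : is_derive t 1 tilted_mean _) _).
rewrite /tilted_var /tilted_mean /GRing.scale/= exprMn exprVn.
by move: n0; move: (exp_moment 0 t) (exp_moment 1 t) (exp_moment 2 t) => x y z x0; field.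
Qed.

Lemma continuous_tilted_var : continuous tilted_var.
Proof.
have c k : continuous (exp_moment k).
  move=> t; apply: differentiable_continuous; apply/derivable1_diffP.
  by case: (is_derive_exp_moment k t).
have n0 t : exp_moment 0 t != 0 by rewrite gt_eqF.
have cV t : (fun s => (exp_moment 0 s)^-1) @ t --> (exp_moment 0 t)^-1.
  by apply: cvgV => //; exact: c.
move=> t; apply: (@cvgB _ R^o); first by apply: cvgM; [exact: c|exact: cV].
rewrite /tilted_mean; under eq_fun do rewrite expr2; rewrite expr2.
by apply: cvgM; apply: cvgM; first [exact: c|exact: cV].
Qed.

(** Expanding the integral of [(h - c)^2] at the mean [c] gives the mass times the variance. The
    sign is what later permits monotone convergence and Tonelli. *)
Lemma tilted_var_ge0 t : 0 <= tilted_var t.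
Proof.
set c := tilted_mean t.
have M1 : exp_moment 1 t = c * exp_moment 0 t by rewrite /c/tilted_mean divfK// gt_eqF.
rewrite /tilted_var -/c.
have : 0 <= \int[m]_x ((h x - c) ^+ 2 * expR (t * h x) * w x).
  by apply: Rintegral_ge0 => x _; rewrite mulr_ge0// mulr_ge0 ?expR_ge0 ?sqr_ge0.
have -> : \int[m]_x ((h x - c) ^+ 2 * expR (t * h x) * w x) =
   exp_moment 2 t - (2 * c) * exp_moment 1 t + c ^+ 2 * exp_moment 0 t.
  rewrite -RintegralZl//; last exact: (integrable_exp_moment 1 t).
  rewrite -RintegralZl//; last exact: (integrable_exp_moment 0 t).
  have i1 := integrable_exp_moment 2 t.
  have i2 : m.-integrable setT (EFin \o (fun x => 2 * c * (h x ^+ 1 * expR (t * h x) * w x))).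
    rewrite /comp; under eq_fun do rewrite EFinM.
    by apply: integrableZl => //; exact: integrable_exp_moment.
  have i3 : m.-integrable setT (EFin \o (fun x => c ^+ 2 * (h x ^+ 0 * expR (t * h x) * w x))).
    rewrite /comp; under eq_fun do rewrite EFinM.
    by apply: integrableZl => //; exact: integrable_exp_moment.
  rewrite -RintegralB// -RintegralD//; last first.
    by rewrite /comp; under eq_fun do rewrite EFinB; exact: integrableB.
  by apply: eq_Rintegral => x _; rewrite expr0 expr1; ring.
rewrite M1 => h0; rewrite subr_ge0 ler_pdivlMr//; nra.
Qed.

End exponential_family.

(** * Gaussian integration by parts *)

Section gaussian.
Context (R : realType) (s : R) (s0 : 0 < s).
Local Notation mu := (@lebesgue_measure R).
Local Notation p := (normal_pdf 0 s).

Lemma normal_pdf_exp x : p x = normal_peak s * expR (- (x ^+ 2 / (s ^+ 2 *+ 2))).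
Proof. by rewrite normal_pdfE ?gt_eqF// /normal_fun subr0 mulNr. Qed.

Lemma is_derive_normal_pdf (x : R) : is_derive x (1 : R) p (- (x / s ^+ 2) * p x).
Proof.
have H : is_derive x (1 : R) (fun y : R => - (y ^+ 2 / (s ^+ 2 *+ 2))) (- (x / s ^+ 2)).
  have := is_deriveZ (- (s ^+ 2 *+ 2)^-1) (is_deriveX 2 (is_derive_id x (1 : R))).
  rewrite (_ : _ \*: _ = fun y : R => - (y ^+ 2 / (s ^+ 2 *+ 2))); last first.
    by apply/funext => y; rewrite -[LHS]/(- (s ^+ 2 *+ 2)^-1 * y ^+ 2); ring.
  move=> H; apply: is_derive_eq.
  rewrite -[LHS]/(- (s ^+ 2 *+ 2)^-1 * (2 * x ^+ 1 * 1)) -mulr_natr.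
  by field; rewrite gt_eqF.
have := is_deriveZ (normal_peak s) (is_derive1_comp (is_derive_expR _) H).
rewrite (_ : _ \*: _ = p); last first.
  by apply/funext => y; rewrite normal_pdf_exp.
by move=> {}H; apply: is_derive_eq; rewrite normal_pdf_exp /GRing.scale/=; ring.
Qed.

(** The extra 1 added to [b] leaves an integrable factor [expR (- |x|)] after a growth of rate [b]
    has been absorbed. *)
Definition normal_tail_const (b : R) : R :=
  normal_peak s * expR ((b + 1) ^+ 2 * s ^+ 2 / 2).

(* AM-GM: [(b + 1) |x| <= x^2 / (2 s^2) + (b + 1)^2 s^2 / 2] *)
Lemma normal_tail b x : expR (b * `|x|) * p x <= normal_tail_const b * expR (- `|x|).
Proof.
rewrite normal_pdf_exp /normal_tail_const [leLHS]mulrCA -[leRHS]mulrA ler_wpM2l ?normal_peak_ge0//.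
rewrite -!expRD ler_expR.
have -> : x ^+ 2 = `|x| ^+ 2 by rewrite real_normK ?num_real.
have := sqr_ge0 (`|x| / s - (b + 1) * s); rewrite sqrrB.
have -> : `|x| / s * ((b + 1) * s) = (b + 1) * `|x| by field; rewrite gt_eqF.
have -> : `|x| ^+ 2 / (s ^+ 2 *+ 2) = (`|x| / s) ^+ 2 / 2.
  by rewrite -mulr_natr; field; rewrite gt_eqF.
rewrite exprMn.
by nra.
Qed.

Lemma integrable_exp_norm : mu.-integrable [set: R] (fun x : R => (expR (- `|x|))%:E).
Proof.
have me1 : measurable_fun [set: R] (fun x : R => (expR (- `|x|))%:E).
  by apply/measurable_EFinP; apply: measurableT_comp => //; apply: measurableT_comp.
apply/integrableP; split => //; under eq_integral do rewrite gee0_abs ?lee_fin ?expR_ge0//.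
by rewrite integral_exp_norm ltry.
Qed.

Lemma integrable_normal_tail (g : R -> R) C b : measurable_fun [set: R] g ->
  (forall x, `|g x| <= C * expR (b * `|x|)) ->
  mu.-integrable [set: R] (fun x => (g x * p x)%:E).
Proof.
move=> mg gC; have C0 : 0 <= C.
  by have := le_trans (normr_ge0 _) (gC 0); rewrite pmulr_lge0// expR_gt0.
apply: (@le_integrable _ _ _ mu _ measurableT _
    (fun x => (C * normal_tail_const b)%:E * (expR (- `|x|))%:E)%E).
- apply/measurable_EFinP; apply: measurable_funM => //; exact: measurable_normal_pdf.
- move=> x _ /=; rewrite lee_fin normrM (ger0_norm (normal_pdf_ge0 _ _ _)).
  apply: le_trans (ler_norm _).
  apply: (@le_trans _ _ (C * expR (b * `|x|) * p x)).
    by rewrite ler_wpM2r ?normal_pdf_ge0.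
  by rewrite -[leLHS]mulrA -[leRHS]mulrA ler_wpM2l// normal_tail.
- by apply: integrableZl => //; exact: integrable_exp_norm.
Qed.

Lemma integral_normal_prob (f : R -> \bar R) : measurable_fun [set: R] f ->
  (\int[normal_prob 0%R s]_x f x = \int[mu]_x (f x * (p x)%:E))%E.
Proof.
move=> mf; apply: integral_density => //; [exact: measurable_normal_pdf|].
by move=> x; exact: normal_pdf_ge0.
Qed.

Lemma integrable_normal_prob (g : R -> R) C b : measurable_fun [set: R] g ->
  (forall x, `|g x| <= C * expR (b * `|x|)) ->
  (normal_prob 0 s).-integrable [set: R] (EFin \o g).
Proof.
move=> mg gC; apply/integrableP; split; first exact/measurable_EFinP.
rewrite integral_normal_prob; last by do 2 apply: measurableT_comp => //.
have /integrableP[_] := integrable_normal_tail mg gC.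
under eq_integral do rewrite EFinM abseM (@gee0_abs _ (p _)%:E) ?lee_fin ?normal_pdf_ge0//.
by [].
Qed.

Section integration_by_parts.
Variables (f v : R -> R) (C : R).
Hypothesis df : forall x : R, is_derive x (1 : R) f (v x).
Hypotheses (cv : continuous v) (v0 : forall x, 0 <= v x).
Hypothesis fC : forall x, `|f x| <= C * expR `|x|.

Let cf : continuous f.
Proof.
by move=> t; apply: differentiable_continuous; apply/derivable1_diffP; case: (df t).
Qed.

Let cp : continuous p. Proof. by apply: continuous_normal_pdf; rewrite gt_eqF. Qed.

Let xf_bound x : `|x * f x| <= C * expR (2 * `|x|).
Proof.
rewrite normrM mulr_natl mulr2n expRD mulrCA ler_pM//.
by apply: le_trans (expR_ge1Dx _); rewrite lerDr.
Qed.

Let mxf : measurable_fun [set: R] (fun x => x * f x).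
Proof. by apply: measurable_funM => //; exact: continuous_measurable_fun. Qed.

Let dF (x : R) : is_derive x (1 : R) (f * p) (v x * p x - x * f x * p x / s ^+ 2).
Proof.
apply: is_derive_eq (is_deriveM (df x) (is_derive_normal_pdf x)) _.
by rewrite /GRing.scale/=; ring.
Qed.

Let F_bound x : `|f x * p x| <= C * normal_tail_const 1 * expR (- `|x|).
Proof.
have C0 : 0 <= C.
  by have := le_trans (normr_ge0 _) (fC 0); rewrite pmulr_lge0// expR_gt0.
rewrite normrM (ger0_norm (normal_pdf_ge0 _ _ _)).
apply: (@le_trans _ _ (C * expR `|x| * p x)).
  by rewrite ler_wpM2r ?normal_pdf_ge0.
by rewrite -[leLHS]mulrA -[leRHS]mulrA ler_wpM2l//; have := normal_tail 1 x; rewrite mul1r.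
Qed.

Let cvg_F (e : R) : `|e| = 1 -> f (e * n%:R) * p (e * n%:R) @[n --> \oo] --> (0 : R).
Proof.
move=> e1; apply: norm_cvg0.
have ub : \forall n \near \oo, (fun=> 0 : R) n <= `|f (e * n%:R) * p (e * n%:R)| <=
    C * normal_tail_const 1 * expR (- n%:R).
  apply: nearW => n; rewrite normr_ge0/=; apply: le_trans (F_bound _) _.
  by rewrite normrM e1 mul1r normr_nat.
apply: (squeeze_cvgr ub); first exact: cvg_cst.
rewrite -[X in _ --> X](mulr0 (C * normal_tail_const 1)); apply: cvgM; first exact: cvg_cst.
exact: cvgn_expR.
Qed.

Let I n : set R := `[- n%:R, n%:R]%classic.

(** The fundamental theorem for [f * p] on [[-n, n]], with [p' = - x p / s^2]. The degenerate
    interval [n = 0] is treated apart, as the theorem is invoked with strictly ordered endpoints. *)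
Let FTC n : (\int[mu]_(x in I n) (v x * p x)%:E =
  \int[mu]_(x in I n) (x * f x * p x / s ^+ 2)%:E +
  (f n%:R * p n%:R - f (- n%:R) * p (- n%:R))%:E)%E.
Proof.
have cxf : continuous (fun x : R => x * f x * p x / s ^+ 2).
  move=> x; apply: cvgM; last exact: cvg_cst.
  by apply: cvgM; [apply: cvgM => //; exact: cf|exact: cp].
have cvp : continuous (fun x : R => v x * p x).
  by move=> x; apply: cvgM; [exact: cv|exact: cp].
case: n => [|n].
  rewrite /I oppr0 set_itv1 !integral_set1.
  by rewrite subrr adde0.
have n0 : - (n.+1%:R : R) < n.+1%:R by rewrite (@lt_trans _ _ 0) ?ltr0n// oppr_lt0 ltr0n.
have intI (g : R -> R) : continuous g -> mu.-integrable (I n.+1) (EFin \o g).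
  move=> cg; apply: continuous_compact_integrable; first exact: segment_compact.
  exact: continuous_subspaceT.
have cF : continuous (f * p).
  by move=> x; apply: differentiable_continuous; apply/derivable1_diffP; case: (dF x).
have := @continuous_FTC2 R (fun x => v x * p x - x * f x * p x / s ^+ 2) (f * p) _ _ n0.
rewrite integralB_EFin//; last 2 first.
  exact: intI.
  exact: intI.
rewrite -/(I n.+1).
set A := (\int[mu]_(x in I n.+1) (v x * p x)%:E)%E.
set B := (\int[mu]_(x in I n.+1) (x * f x * p x / s ^+ 2)%:E)%E.
move=> H; have -> : (f n.+1%:R * p n.+1%:R - f (- n.+1%:R) * p (- n.+1%:R))%:E = (A - B)%E.
  apply/esym/H.
  - by apply: continuous_subspaceT => x; apply: (@cvgB _ R^o); [exact: cvp|exact: cxf].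
  - split; first by move=> x _; case: (dF x).
      by apply: cvg_at_right_filter; exact: cF.
    by apply: cvg_at_left_filter; exact: cF.
  - by move=> x _; rewrite derive1E; case: (dF x).
rewrite addeC subeK// /B integrable_fin_num//; first exact: measurable_itv.
exact: (intI _ cxf).
Qed.

Let bigcupI : \bigcup_n I n = [set: R].
Proof.
rewrite -subTset => x _; exists (Num.truncn `|x|).+1 => //.
by rewrite /I/= in_itv/= -ler_norml ltW// truncnS_gt.
Qed.

Let ndI : nondecreasing_seq I.
Proof.
move=> a b ab; apply/subsetPset => x; rewrite /I/= !in_itv/= -!ler_norml.
by move=> /le_trans; apply; rewrite ler_nat.
Qed.

(** The limit of [FTC]. The bound is on [f] only: the integral of [v * p] converges monotonically
    because [v] is nonnegative, that of [x * f * p] by domination, and the boundary terms vanish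
    since the density beats [expR |x|]. *)
Lemma gaussian_integration_by_parts :
  (\int[normal_prob 0%R s]_x (x * f x)%:E =
   (s ^+ 2)%:E * \int[normal_prob 0%R s]_x (v x)%:E)%E.
Proof.
have mv : measurable_fun [set: R] v by exact: continuous_measurable_fun.
have mp : measurable_fun [set: R] p := measurable_normal_pdf 0 s.
rewrite !integral_normal_prob; [|exact/measurable_EFinP..].
have ixf := integrable_normal_tail mxf xf_bound.
have cvgv : (\int[mu]_(x in I n) (v x * p x)%:E)%E @[n --> \oo] -->
    (\int[mu]_x (v x * p x)%:E)%E.
  rewrite -bigcupI; apply: ge0_nondecreasing_set_cvg_integral => //.
  - by move=> n; exact: measurable_itv.
  - by move=> n; apply/measurable_funTS/measurable_EFinP; exact: measurable_funM.
  - by move=> n x _; rewrite lee_fin mulr_ge0// normal_pdf_ge0.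
have ixf2 : mu.-integrable [set: R] (fun x => (x * f x * p x / s ^+ 2)%:E).
  by under eq_fun do rewrite EFinM muleC; exact: integrableZl.
have cvgxf : (\int[mu]_(x in I n) (x * f x * p x / s ^+ 2)%:E)%E @[n --> \oo] -->
    (\int[mu]_x (x * f x * p x / s ^+ 2)%:E)%E.
  under eq_fun do rewrite integral_mkcond.
  apply: (@dominated_cvg _ _ _ mu _ measurableT _ _
      (fun x => `|(x * f x * p x / s ^+ 2)%:E|%E)) => //.
  - move=> n; apply/(measurable_restrictT _ _).1 => //; first exact: measurable_itv.
    by apply: measurable_funTS; exact: measurable_int ixf2.
  - move=> x _; apply: cvg_near_cst.
    have [n _ In] : (\bigcup_n I n) x by rewrite bigcupI.
    exists n => // k nk; rewrite patchE mem_set//.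
    by move/subsetPset: (ndI nk); exact.
  - exact: integrable_abse.
  - by move=> n x _; rewrite patchE; case: ifP => // _; rewrite abse0.
have cvgF : (f n%:R * p n%:R - f (- n%:R) * p (- n%:R))%:E @[n --> \oo] --> 0%E.
  apply: cvg_EFin; first exact: nearW.
  rewrite -[X in _ --> X]subr0; apply: (@cvgB _ R^o).
    by have := @cvg_F 1 (normr1 _); under eq_fun do rewrite mul1r.
  by have := @cvg_F (-1) (normrN1 _); under eq_fun do rewrite mulN1r.
have cvgv2 : (\int[mu]_(x in I n) (v x * p x)%:E)%E @[n --> \oo] -->
    (\int[mu]_x (x * f x * p x / s ^+ 2)%:E + 0)%E.
  under eq_fun do rewrite FTC.
  by apply: cvgeD cvgxf cvgF; rewrite fin_num_adde_defl.
have -> : (\int[mu]_x ((v x)%:E * (p x)%:E) = \int[mu]_x (x * f x * p x / s ^+ 2)%:E)%E.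
  rewrite -[RHS]adde0; under eq_integral do rewrite -EFinM.
  exact: cvg_unique cvgv cvgv2.
under [in RHS]eq_integral do rewrite EFinM muleC.
rewrite integralZl// muleA -EFinM divff ?mul1e// expf_neq0// gt_eqF//.
Qed.

End integration_by_parts.

End gaussian.

(** * Joint laws of independent variables *)

Section tuple_box.
Context dE (E : measurableType dE) (R : realType) (n : nat).

Definition tuple_box (B : 'I_n -> set E) : set (n.-tuple E) :=
  [set t | forall j, B j (tnth t j)].

Lemma tuple_box_bigI B : tuple_box B = \bigcap_(j in [set: 'I_n]) (@tnth n E ^~ j @^-1` B j).
Proof. by apply/seteqP; split => t /= Bt j; [move=> _; exact: Bt|exact: Bt]. Qed.

Lemma measurable_tuple_box B : (forall j, measurable (B j)) -> measurable (tuple_box B).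
Proof.
move=> mB; rewrite tuple_box_bigI; apply: fin_bigcap_measurable => // j _.
by rewrite -[X in measurable X]setTI; exact: (@measurable_tnth _ _ _ j).
Qed.

(** A pi-system argument: boxes are stable under intersection and include the whole space, and they
    generate the sigma-algebra because a cylinder over one coordinate is a box with full sides
    elsewhere. *)
Lemma tuple_measure_unique (m1 m2 : {measure set (n.-tuple E) -> \bar R}) :
  (m1 setT < +oo)%E ->
  (forall B, (forall j, measurable (B j)) -> m1 (tuple_box B) = m2 (tuple_box B)) ->
  forall A, measurable A -> m1 A = m2 A.
Proof.
move=> m1oo m12; pose G := [set A | exists2 B, (forall j, measurable (B j)) & A = tuple_box B].
have GT : G setT.
  by exists (fun=> setT) => //; apply/seteqP; split.
apply: (measure_unique G (fun=> setT)) => //.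
- apply/seteqP; split.
    apply: sub_sigma_algebra2; apply: (big_ind (fun U => U `<=` G)) => //.
      by move=> U W UG WG A [/UG|/WG].
    move=> i _ _ [B mB <-]; exists (fun j => if j == i then B else setT).
      by move=> j; case: ifP.
    apply/seteqP; split => t /=; first by move=> [_ Bt] j; case: eqP => // ->.
    by move=> /(_ i); rewrite eqxx.
  apply: smallest_sub; first exact: sigma_algebra_measurable.
  by move=> _ [B mB ->]; exact: measurable_tuple_box.
- move=> _ _ [B mB ->] [C mC ->]; exists (fun j => B j `&` C j).
    by move=> j; exact: measurableI.
  by apply/seteqP; split=> t /=; [case=> Bt Ct j; split; [exact: Bt|exact: Ct] |
    move=> BC; split => j; have [] := BC j].
- by rewrite bigcup_const.
- by move=> _ [B mB ->]; exact: m12.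
Qed.

End tuple_box.

Section independence.
Context dT (T : measurableType dT) (R : realType) (P : probability T R).
Context dD (D : measurableType dD) dE (E : measurableType dE) (n : nat).
Variables (X : {mfun T >-> D}) (Y : {mfun T >-> n.-tuple E}).
Local Open Scope ereal_scope.

Hypothesis indep : forall A B, measurable A -> (forall j, measurable (B j)) ->
  P (X @^-1` A `&` Y @^-1` tuple_box B) = P (X @^-1` A) * P (Y @^-1` tuple_box B).

(** For fixed [A] both sides are finite measures in [B] that agree on boxes. *)
Lemma indep_tuple A B : measurable A -> measurable B ->
  P (X @^-1` A `&` Y @^-1` B) = P (X @^-1` A) * P (Y @^-1` B).
Proof.
move=> mA mB.
have mXA : measurable (X @^-1` A) by exact: measurable_funPTI.
have PXA : P (X @^-1` A) \is a fin_num by exact: fin_num_measure.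
have r0 : (0 <= fine (P (X @^-1` A)))%R by rewrite fine_ge0.
have mY : measurable_fun [set: T] Y by exact: measurable_funP.
pose m1 := pushforward (mrestr P mXA) Y.
pose m2 := mscale (NngNum r0) (distribution P Y).
have m12 := @tuple_measure_unique _ _ R n m1 m2.
rewrite setIC -[LHS]/(m1 B); transitivity (m2 B); last by rewrite /m2 /mscale/= fineK.
apply: m12 => //.
- by rewrite /m1 /= /pushforward preimage_setT /mrestr setTI ltey_eq PXA.
- by move=> C mC; rewrite /m1 /m2 /= /mscale/= fineK// /pushforward /mrestr setIC indep.
Qed.

Lemma joint_law A : measurable A ->
  (distribution P X \x distribution P Y) A = pushforward P (fun w => (X w, Y w)) A.
Proof.
have mXY : measurable_fun [set: T] (fun w => (X w, Y w)) by exact: measurable_fun_pair.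
apply: product_measure_unique => B C mB mC.
rewrite /= /pushforward -indep_tuple//; congr (P _).
Qed.

Lemma ge0_integral_indep (F : D * n.-tuple E -> \bar R) :
  measurable_fun [set: D * n.-tuple E] F -> (forall z, 0 <= F z) ->
  \int[P]_w F (X w, Y w) = \int[distribution P Y]_y \int[distribution P X]_x F (x, y).
Proof.
move=> mF F0.
have mXY : measurable_fun [set: T] (fun w => (X w, Y w)) by exact: measurable_fun_pair.
have := @ge0_integral_pushforward _ _ _ _ R _ mXY P setT F measurableT mF (fun y _ => F0 y).
rewrite preimage_setT => <-.
rewrite (eq_measure_integral (distribution P X \x distribution P Y)).
  exact: fubini_tonelli2.
by move=> A mA _; apply/esym; exact: joint_law.
Qed.

Lemma integrable_joint_law (F : D * n.-tuple E -> \bar R) :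
  measurable_fun [set: D * n.-tuple E] F ->
  P.-integrable [set: T] (fun w => F (X w, Y w)) ->
  (distribution P X \x distribution P Y).-integrable [set: D * n.-tuple E] F.
Proof.
move=> mF /integrableP[_ FP]; apply/integrableP; split => //.
rewrite fubini_tonelli2//; last exact: measurableT_comp.
by rewrite -ge0_integral_indep//; exact: measurableT_comp.
Qed.

Lemma integral_indep (F : D * n.-tuple E -> \bar R) :
  measurable_fun [set: D * n.-tuple E] F ->
  P.-integrable [set: T] (fun w => F (X w, Y w)) ->
  \int[P]_w F (X w, Y w) = \int[distribution P Y]_y \int[distribution P X]_x F (x, y).
Proof.
move=> mF iF; have iF2 := integrable_joint_law mF iF.
have mXY : measurable_fun [set: T] (fun w => (X w, Y w)) by exact: measurable_fun_pair.
rewrite (@integral21_prod_meas1 _ _ _ _ _ _ _ F)//.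
rewrite [RHS](@eq_measure_integral _ _ _ _ (pushforward P (fun w => (X w, Y w)))).
  by rewrite integral_pushforward//= preimage_setT.
by move=> A mA _; exact: joint_law.
Qed.

End independence.

(** * Moments of the Gibbs measure *)

Section density_measure.
Context d (X : measurableType d) (R : realType).
Variables (m : {measure set X -> \bar R}).
Local Open Scope ereal_scope.

Definition density_measure (g : {mfun X >-> R}) of (forall x, 0 <= g x)%R : set X -> \bar R :=
  fun A => \int[m]_(x in A) (g x)%:E.

Variables (g : {mfun X >-> R}) (g0 : (forall x, 0 <= g x)%R).

Lemma density_measure0 : density_measure g0 set0 = 0.
Proof. by rewrite /density_measure integral_set0. Qed.

Lemma density_measure_ge0 A : 0 <= density_measure g0 A.
Proof. by apply: integral_ge0 => x _; rewrite lee_fin. Qed.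

Lemma density_measure_sigma_additive : semi_sigma_additive (density_measure g0).
Proof.
move=> F mF tF mUF; rewrite /density_measure ge0_integral_bigcup//=.
- by apply: is_cvg_ereal_nneg_natsum_cond => n _ _; exact: density_measure_ge0.
- by apply/measurable_funTS/measurable_EFinP.
- by move=> x _; rewrite lee_fin.
Qed.

HB.instance Definition _ := isMeasure.Build _ _ _ (density_measure g0)
  density_measure0 density_measure_ge0 density_measure_sigma_additive.

End density_measure.

Section gibbs.
Context (R : realType) (d : nat) (V : R -> R) (hV : admissible_potential V) (eps : {nonneg R}).
Local Notation site := 'rV[int]_d.+1.
Variable L : {fset site}.
Implicit Types (i j : site) (eta : site -> R).
Local Notation ref := (reference_measure eps L).
Local Notation W eta := (fun phi : config R L => expR (log_weight V eta phi)).
Local Notation S := (fun phi : config R L => \sum_(x <- phi) `|x|).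
Local Notation H eta := (\sum_(j <- L) `|eta j|).

Lemma measurable_height i : measurable_fun [set: config R L] (fun phi : config R L => height phi i).
Proof.
have [iL|iL] := boolP (i \in L); last first.
  by under eq_fun do rewrite height_notin//; exact: measurable_cst.
have iL' : (index i (enum_fset L) < #|` L|)%N by rewrite index_mem.
rewrite (_ : (fun _ => _) = (@tnth _ _)^~ (Ordinal iL')); first exact: measurable_tnth.
by apply/funext => phi; rewrite (tnth_nth 0).
Qed.

Lemma measurable_log_weight dZ (Z : measurableType dZ) (eta : Z -> site -> R)
    (Phi : Z -> config R L) :
  (forall j, measurable_fun [set: Z] (eta ^~ j)) -> measurable_fun [set: Z] Phi ->
  measurable_fun [set: Z] (fun z => log_weight V (eta z) (Phi z)).
Proof.
move=> meta mPhi.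
have mV : measurable_fun [set: R] V.
  by apply: continuous_measurable_fun; exact: admissible_continuous.
have mh i : measurable_fun [set: Z] (fun z => height (Phi z) i).
  exact: (measurableT_comp (measurable_height i) mPhi).
have msum (I : Type) (r : seq I) (Q : pred I) (f : I -> Z -> R) :
    (forall k, measurable_fun [set: Z] (f k)) ->
    measurable_fun [set: Z] (fun z => \sum_(k <- r | Q k) f k z).
  by move=> mf; under eq_fun do rewrite -big_filter; exact: measurable_sum.
rewrite /log_weight; apply: measurable_funD.
  apply: measurable_funB; apply: measurable_funM => //.
    apply: (msum _ _ _ (fun i z => \sum_(k < d.+1 | i + unit_vec k \in L)
      V (height (Phi z) i - height (Phi z) (i + unit_vec k)))) => i.
    apply: (msum _ _ _ (fun k z => V (height (Phi z) i - height (Phi z) (i + unit_vec k)))) => k.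
    by apply: measurableT_comp => //; exact: measurable_funB.
  apply: (msum _ _ _ (fun i z => \sum_(j <- neighbors i | j \notin L) V (height (Phi z) i))) => i.
  apply: (msum _ _ _ (fun j z => V (height (Phi z) i))) => j.
  exact: measurableT_comp.
by apply: (msum _ _ _ (fun i z => eta z i * height (Phi z) i)) => i; exact: measurable_funM.
Qed.

Lemma measurable_weight eta : measurable_fun [set: config R L] (W eta).
Proof.
apply: measurableT_comp => //; apply: (@measurable_log_weight _ _ (fun=> eta) id).
  by move=> j; exact: measurable_cst.
exact: measurable_id.
Qed.

Lemma measurable_norm_sum : measurable_fun [set: config R L] S.
Proof. exact: measurable_sum_norm_tuple. Qed.

Lemma height_le_sum i (phi : config R L) : `|height phi i| <= S phi.
Proof.
have [iL|/height_notin ->] := boolP (i \in L); last by rewrite normr0 sumr_ge0.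
by rewrite -(sum_height phi) (big_fsetD1 i)//= lerDl sumr_ge0.
Qed.

Lemma integrable_exp_neg_sum : ref.-integrable setT (fun phi => (expR (- S phi))%:E).
Proof.
apply/integrableP; split.
  apply/measurable_EFinP; apply: measurableT_comp => //; apply: measurableT_comp => //.
  exact: measurable_norm_sum.
under eq_integral do rewrite gee0_abs ?lee_fin ?expR_ge0//.
exact/tuple_product_exp_sum_norm/single_site_exp_norm.
Qed.

Lemma integrable_exp_sum_weight eta (B : R) : 0 <= B ->
  ref.-integrable setT (fun phi => (expR (B * S phi) * W eta phi)%:E).
Proof.
move=> B0; have [C [n [C0 bound]]] := log_weight_le hV L.
(* Slope [B + 1] in [log_weight_le]: [B] cancels the growth and the spare 1 leaves [expR (- S)]. *)
pose K := C * (1 + (B + 1) + H eta) ^+ n.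
apply: (@le_integrable _ _ _ ref _ measurableT _
    (fun phi => (expR K)%:E * (expR (- S phi))%:E)%E).
- apply/measurable_EFinP; apply: measurable_funM; last exact: measurable_weight.
  apply: measurableT_comp => //; apply: measurable_funM => //.
  exact: measurable_norm_sum.
- move=> phi _ /=; rewrite lee_fin !ger0_norm ?mulr_ge0 ?expR_ge0//.
  rewrite -!expRD ler_expR.
  have B1 : 0 <= B + 1 by rewrite addr_ge0.
  have := bound eta phi (B + 1) B1; rewrite -/K; lra.
- by apply: integrableZl => //; exact: integrable_exp_neg_sum.
Qed.

Lemma integrable_mul_weight eta (f : config R L -> R) C (B : R) : 0 <= B ->
  measurable_fun setT f -> (forall phi, `|f phi| <= C * expR (B * S phi)) ->
  ref.-integrable setT (fun phi => (f phi * W eta phi)%:E).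
Proof.
move=> B0 mf fC.
have C0 : 0 <= C.
  have := le_trans (normr_ge0 _) (fC [tuple 0 | _ < #|` L|]).
  by rewrite pmulr_lge0// expR_gt0.
apply: (@le_integrable _ _ _ ref _ measurableT _
    (fun phi => C%:E * (expR (B * S phi) * W eta phi)%:E)%E).
- by apply/measurable_EFinP; apply: measurable_funM => //; exact: measurable_weight.
- move=> phi _ /=; rewrite lee_fin normrM (ger0_norm (expR_ge0 _)).
  apply: le_trans (ler_norm _); rewrite mulrA ler_wpM2r ?expR_ge0//.
- by apply: integrableZl => //; exact: integrable_exp_sum_weight.
Qed.

Lemma integrable_weight eta : ref.-integrable setT (fun phi => (W eta phi)%:E).
Proof.
have := integrable_exp_sum_weight eta (lexx 0).
by under eq_fun do rewrite mul0r expR0 mul1r.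
Qed.

Lemma partition_functionE eta :
  partition_function V eps L eta = (\int[ref]_phi W eta phi)%:E.
Proof.
rewrite /partition_function /Rintegral fineK//.
exact: integrable_fin_num (integrable_weight eta).
Qed.

(** Otherwise the weight would vanish almost everywhere; an exponential vanishes nowhere, so the
    whole space would be null, against the positive mass of the reference measure. *)
Lemma partition_function_gt0 eta : 0 < \int[ref]_phi W eta phi.
Proof.
rewrite lt_neqAle Rintegral_ge0 ?andbT; last by move=> *; exact: expR_ge0.
apply/negP => /eqP Z0.
have : (\int[ref]_phi `|(W eta phi)%:E| = 0)%E.
  rewrite -[RHS]/((0 : R)%:E) Z0 -partition_functionE.
  by apply: eq_integral => phi _; rewrite gee0_abs// lee_fin expR_ge0.
have mW : measurable_fun setT (fun phi => (W eta phi)%:E).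
  by apply/measurable_EFinP; exact: measurable_weight.
move/(ae_eq_integral_abs ref measurableT mW).1 => [A [mA A0 WA]].
have := tuple_product_gt0 #|` L| (single_site_gt0 eps).
rewrite -[tuple_product _ _ _]/(ref setT) (_ : setT = A) ?A0 ?ltxx//.
apply/esym; rewrite -subTset => phi _; apply: WA => /= /(_ I) [].
by apply/eqP; rewrite gt_eqF// expR_gt0.
Qed.

Lemma gibbs_meanE eta (f : config R L -> R) : measurable_fun setT f ->
  ref.-integrable setT (fun phi => (f phi * W eta phi)%:E) ->
  gibbs_mean V eps eta f = (\int[ref]_phi (f phi * W eta phi)) / \int[ref]_phi W eta phi.
Proof.
move=> mf fW.
set Z := \int[ref]_phi W eta phi.
have Z0 : 0 < Z := partition_function_gt0 eta.
have Zi0 : 0 <= Z^-1 by rewrite invr_ge0 ltW.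
pose w : {mfun config R L >-> R} := HB.pack (W eta)
  (isMeasurableFun.Build _ _ _ _ _ (measurable_weight eta)).
have w0 phi : 0 <= w phi by exact: expR_ge0.
(* [gibbs] is a bare set function; it is identified with this genuine measure so that the
   integration lemmas apply. *)
pose nu := mscale (NngNum Zi0) (density_measure ref w0).
rewrite /gibbs_mean (_ : gibbs V eps eta = nu); last first.
  by apply/funext => A; rewrite /gibbs partition_functionE.
have mw := measurable_weight eta.
rewrite (@integral_density _ _ _ ref nu (fun phi => Z^-1 * W eta phi)).
- under eq_integral do rewrite -EFinM mulrCA EFinM.
  rewrite integralZl//= fineM//; last exact: integrable_fin_num fW.
  by rewrite mulrC.
- exact: measurable_funM.
- by move=> phi; rewrite mulr_ge0// expR_ge0.
- move=> A mA; rewrite /nu /mscale/= /density_measure.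
  under [RHS]eq_integral do rewrite EFinM.
  rewrite integralZl//; exact: integrableS (integrable_weight eta).
- exact/measurable_EFinP.
Qed.

Definition set_field eta i t : site -> R := fun j => if j == i then t else eta j.

Lemma set_field_id eta i : set_field eta i (eta i) = eta.
Proof. by apply/funext => j; rewrite /set_field; case: eqP => // ->. Qed.

Section one_site.
Variables (eta : site -> R) (i : site).
Hypothesis iL : i \in L.
Local Notation h := (fun phi : config R L => height phi i).
Local Notation w := (W (set_field eta i 0)).

(** The field enters the exponent linearly, so changing it at one site of [L] is an exponential tilt
    by the height there. This brings the Gibbs means under the calculus of exponential families. *)
Lemma weight_set_field t phi : W (set_field eta i t) phi = expR (t * h phi) * w phi.
Proof.
rewrite -expRD !log_weight_bond_sum addrCA; congr (expR (_ + _)).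
rewrite (big_fsetD1 i)//= [in RHS](big_fsetD1 i)//= /set_field eqxx mul0r add0r.
congr (_ + _); rewrite big_seq [RHS]big_seq; apply: eq_bigr => j.
by rewrite !inE => /andP[/negbTE ->].
Qed.

Lemma exp_moment_weight k t :
  exp_moment ref h w k t = \int[ref]_phi (h phi ^+ k * W (set_field eta i t) phi).
Proof. by apply: eq_Rintegral => phi _; rewrite -mulrA -weight_set_field. Qed.

Lemma integrable_exp_height (B : R) :
  ref.-integrable setT (fun phi => (expR (B * `|h phi|) * w phi)%:E).
Proof.
apply: (@integrable_mul_weight _ _ 1 `|B|) => //.
  apply: measurableT_comp => //; apply: measurable_funM => //.
  by apply: measurableT_comp => //; exact: measurable_height.
move=> phi; rewrite mul1r ger0_norm ?expR_ge0// ler_expR.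
apply: (@le_trans _ _ (`|B| * `|h phi|)).
  by rewrite ler_wpM2r// ler_norm.
by rewrite ler_wpM2l// height_le_sum.
Qed.

Lemma mass_weight_gt0 t : 0 < exp_moment ref h w 0 t.
Proof.
rewrite exp_moment_weight; under eq_Rintegral do rewrite expr0 mul1r.
exact: partition_function_gt0.
Qed.

Lemma gibbs_mean_pow k t :
  gibbs_mean V eps (set_field eta i t) (fun phi : config R L => h phi ^+ k) =
  exp_moment ref h w k t / exp_moment ref h w 0 t.
Proof.
rewrite gibbs_meanE.
- rewrite !exp_moment_weight; congr (_ / _).
  by apply: eq_Rintegral => phi _; rewrite expr0 mul1r.
- by apply: measurable_funX; exact: measurable_height.
- under eq_fun do rewrite weight_set_field mulrA.
  exact: (integrable_exp_moment (measurable_height i) (measurable_weight _)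
    (fun=> expR_ge0 _) integrable_exp_height k t).
Qed.

Lemma mean_height_set_field t :
  mean_height V eps L (set_field eta i t) i = tilted_mean ref h w t.
Proof. by have := gibbs_mean_pow 1 t; under eq_fun do rewrite expr1. Qed.

Lemma var_height_set_field t :
  var_height V eps L (set_field eta i t) i = tilted_var ref h w t.
Proof. by rewrite /var_height mean_height_set_field gibbs_mean_pow. Qed.

Lemma is_derive_mean_height t :
  is_derive t (1 : R) (fun t => mean_height V eps L (set_field eta i t) i)
    (var_height V eps L (set_field eta i t) i).
Proof.
rewrite var_height_set_field (_ : (fun t => _) = tilted_mean ref h w).
  exact: (is_derive_tilted_mean (measurable_height i) (measurable_weight _)
    (fun=> expR_ge0 _) integrable_exp_height mass_weight_gt0).
by apply/funext => u; exact: mean_height_set_field.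
Qed.

Lemma continuous_var_height :
  continuous (fun t : R => var_height V eps L (set_field eta i t) i).
Proof.
rewrite (_ : (fun t => _) = tilted_var ref h w).
  exact: (continuous_tilted_var (measurable_height i) (measurable_weight _)
    (fun=> expR_ge0 _) integrable_exp_height mass_weight_gt0).
by apply/funext => u; exact: var_height_set_field.
Qed.

Lemma var_height_set_field_ge0 t : 0 <= var_height V eps L (set_field eta i t) i.
Proof.
rewrite var_height_set_field.
exact: (tilted_var_ge0 (measurable_height i) (measurable_weight _)
    (fun=> expR_ge0 _) integrable_exp_height mass_weight_gt0).
Qed.

End one_site.

Lemma var_height_ge0 eta i : i \in L -> 0 <= var_height V eps L eta i.
Proof.
by move=> iL; rewrite -(set_field_id eta i); exact: var_height_set_field_ge0.
Qed.

End gibbs.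

(** * Bounds on the mean heights *)

Section growth.
Context (R : realType) (d : nat) (V : R -> R) (hV : admissible_potential V) (eps : {nonneg R}).
Local Notation site := 'rV[int]_d.+1.
Variable L : {fset site}.
Implicit Types (i j : site) (eta : site -> R).
Local Notation ref := (reference_measure eps L).
Local Notation W eta := (fun phi : config R L => expR (log_weight V eta phi)).
Local Notation S := (fun phi : config R L => \sum_(x <- phi) `|x|).
Local Notation H eta := (\sum_(j <- L) `|eta j|).

Lemma exprn_le_fact_expR n (x : R) : 0 <= x -> x ^+ n <= n`!%:R * expR x.
Proof.
move=> x0; case: n => [|n]; first by rewrite expr0 mul1r -expR0 ler_expR.
rewrite mulrC -ler_pdivrMr ?ltr0n ?fact_gt0//.
by apply: le_trans (expR_ge1Dxn n x0); rewrite lerDr.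
Qed.

Lemma sum_norm_le_expR (phi : config R L) : S phi <= expR (S phi).
Proof. by apply: le_trans (expR_ge1Dx _); rewrite lerDr. Qed.

Lemma sum_norm_ge0 (phi : config R L) : 0 <= S phi.
Proof. exact: sumr_ge0. Qed.

Lemma integrable_sum_weight eta :
  ref.-integrable setT (fun phi => (S phi * W eta phi)%:E).
Proof.
apply: (@integrable_mul_weight _ _ _ hV eps L eta S 1 1) => //.
  exact: measurable_norm_sum.
by move=> phi; rewrite !mul1r ger0_norm ?sum_norm_ge0// sum_norm_le_expR.
Qed.

(* Tangent line of [exp] at the mean [r] of [S] for the zero field:
   [e^(- h S) >= e^(- h r) (1 - h (S - r))]. *)
Lemma partition_function_lower_bound : exists c r : R, [/\ 0 < c, 0 <= r &
  forall eta, c * expR (- (r * H eta)) <= \int[ref]_phi W eta phi].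
Proof.
pose W0 := W (fun=> 0).
pose c := \int[ref]_phi W0 phi.
have c0 : 0 < c := partition_function_gt0 hV eps L (fun=> 0).
pose N := \int[ref]_phi (S phi * W0 phi).
have N0 : 0 <= N.
  by apply: Rintegral_ge0 => phi _; rewrite mulr_ge0 ?expR_ge0// sum_norm_ge0.
exists c, (N / c); split; [exact: c0|by rewrite divr_ge0// ltW|].
move=> eta; set h := H eta; set r := N / c.
have h0 : 0 <= h by apply: sumr_ge0.
have iW0 := integrable_weight hV eps L (fun=> 0); rewrite -/W0 in iW0.
have iSW0 := integrable_sum_weight (fun=> 0); rewrite -/W0 in iSW0.
have i1 : ref.-integrable setT (EFin \o (fun phi => (1 + r * h) * W0 phi)).
  by rewrite /comp; under eq_fun do rewrite EFinM; exact: integrableZl.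
have i2 : ref.-integrable setT (EFin \o (fun phi => h * (S phi * W0 phi))).
  by rewrite /comp; under eq_fun do rewrite EFinM; exact: integrableZl.
have i12 : ref.-integrable setT (EFin \o (fun phi => (1 + r * h) * W0 phi - h * (S phi * W0 phi))).
  by rewrite /comp; under eq_fun do rewrite EFinB; exact: integrableB.
have -> : c * expR (- (r * h)) =
    \int[ref]_phi (expR (- (r * h)) * ((1 + r * h) * W0 phi - h * (S phi * W0 phi))).
  rewrite RintegralZl// RintegralB// RintegralZl// RintegralZl// -/c -/N.
  have -> : N = r * c by rewrite /r divfK// gt_eqF.
  ring.
apply: le_Rintegral => //.
- by rewrite /comp; under eq_fun do rewrite EFinM; exact: integrableZl.
- exact: integrable_weight.
move=> phi _; set s := S phi.
have W0le : expR (- (h * s)) * W0 phi <= W eta phi.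
  rewrite -expRD ler_expR !log_weight_bond_sum.
  have := field_term_le eta phi; rewrite -/h -/s ler_norml => /andP[].
  have -> : \sum_(i <- L) (fun=> 0) i * height phi i = 0 :> R.
    by rewrite big1// => j _; rewrite mul0r.
  by rewrite addr0 addrC lerD2l.
apply: le_trans W0le.
have -> : expR (- (r * h)) * ((1 + r * h) * W0 phi - h * (s * W0 phi)) =
   (expR (- (r * h)) * (1 + (r * h - h * s))) * W0 phi by ring.
rewrite ler_wpM2r ?expR_ge0//.
rewrite [X in _ <= expR X](_ : _ = - (r * h) + (r * h - h * s)); last by ring.
by rewrite expRD ler_wpM2l ?expR_ge0// expR_ge1Dx.
Qed.

Lemma mean_height_growth i : exists C : R, 0 <= C /\
  forall eta, `|mean_height V eps L eta i| <= C * expR (H eta).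
Proof.
have [A [n [A0 bound]]] := log_weight_le hV L.
have [c [r [c0 r0 Zlow]]] := partition_function_lower_bound.
pose D := \int[ref]_phi expR (- S phi).
have D0 : 0 <= D by apply: Rintegral_ge0 => *; exact: expR_ge0.
have iD := integrable_exp_neg_sum eps L.
exists (A * n`!%:R * expR 3 + r + D / c); split.
  by rewrite !addr_ge0 ?divr_ge0 ?mulr_ge0 ?expR_ge0// ltW.
move=> eta; set h := H eta.
have h0 : 0 <= h by apply: sumr_ge0.
set Z := \int[ref]_phi W eta phi.
have Z0 : 0 < Z := partition_function_gt0 hV eps L eta.
have ih : ref.-integrable setT (fun phi => (height phi i * W eta phi)%:E).
  apply: (@integrable_mul_weight _ _ _ hV eps L eta _ 1 1) => //.
    exact: measurable_height.
  move=> phi; rewrite !mul1r (le_trans (height_le_sum i phi))//.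
  exact: sum_norm_le_expR.
rewrite /mean_height gibbs_meanE//; last exact: measurable_height.
rewrite -/Z normrM normfV (gtr0_norm Z0) ler_pdivrMr//.
apply: le_trans (le_normr_Rintegral _ ih) _ => //.
(* The first term is the error in [log_weight_le] at slope 2: one unit of slope pays for [expR S],
   the other keeps [expR (- S)]. The term [r * h] matches the lower bound on the partition
   function. *)
pose K := A * (3 + h) ^+ n + r * h.
have K0 : 0 <= K by rewrite addr_ge0 ?mulr_ge0// exprn_ge0// addr_ge0.
have i1 : ref.-integrable setT (EFin \o (fun phi => K * W eta phi)).
  rewrite /comp; under eq_fun do rewrite EFinM; apply: integrableZl => //.
  exact: integrable_weight.
have i2 : ref.-integrable setT (EFin \o (fun phi => expR (- (r * h)) * expR (- S phi))).
  by rewrite /comp; under eq_fun do rewrite EFinM; apply: integrableZl.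
(* From [S <= K + expR (S - K)], integrated against the weight. *)
apply: (@le_trans _ _ (K * Z + expR (- (r * h)) * D)).
  rewrite -RintegralZl//; last exact: integrable_weight.
  rewrite -RintegralZl// -RintegralD//.
  apply: le_Rintegral => //.
  - exact: integrable_abse ih.
  - by rewrite /comp; under eq_fun do rewrite EFinD; exact: integrableD.
  move=> phi _; rewrite normrM (ger0_norm (expR_ge0 _)).
  have W1 : expR (S phi - K) * W eta phi <= expR (- (r * h)) * expR (- S phi).
    rewrite -!expRD ler_expR.
    have := bound eta phi 2 (ler0n _ 2); rewrite -/h.
    have -> : (1 + 2 + h : R) = 3 + h by ring.
    by rewrite /K; lra.
  apply: le_trans (lerD (lexx _) W1); rewrite -mulrDl ler_wpM2r ?expR_ge0//.
  apply: le_trans (height_le_sum i phi) _.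
  have := expR_ge1Dx (S phi - K); lra.
have Dc : expR (- (r * h)) * D <= D / c * Z.
  have := Zlow eta; rewrite -/h -/Z => /(ler_wpM2l (divr_ge0 D0 (ltW c0))).
  suff -> : D / c * (c * expR (- (r * h))) = expR (- (r * h)) * D by [].
  by rewrite mulrA divfK ?gt_eqF// mulrC.
(* The polynomial is relaxed through [x^n <= n! e^x] at [x = 3 + h], whence the factors [n!] and
   [expR 3]. *)
have Kle : K <= (A * n`!%:R * expR 3 + r) * expR h.
  rewrite mulrDl lerD//.
    rewrite -!mulrA ler_wpM2l// -expRD; apply: exprn_le_fact_expR.
    by rewrite addr_ge0.
  by rewrite ler_wpM2l//; apply: le_trans (expR_ge1Dx _); rewrite lerDr.
have eh1 : 1 <= expR h by rewrite -expR0 ler_expR.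
have -> : (A * n`!%:R * expR 3 + r + D / c) * expR h * Z =
  (A * n`!%:R * expR 3 + r) * expR h * Z + D / c * expR h * Z by ring.
apply: lerD; first by rewrite ler_wpM2r// ltW.
apply: le_trans Dc _; rewrite ler_wpM2r ?(ltW Z0)// -[leLHS]mulr1 ler_wpM2l//.
by rewrite divr_ge0// ltW.
Qed.

End growth.

(** * Measurability of Gibbs means in the fields *)

Section measurability.
Context (R : realType) (d : nat) (V : R -> R) (hV : admissible_potential V) (eps : {nonneg R}).
Local Notation site := 'rV[int]_d.+1.
Variable L : {fset site}.
Context dZ (Z : measurableType dZ) (eta : Z -> site -> R).
Hypothesis meta : forall j, measurable_fun [set: Z] (eta ^~ j).
Local Notation ref := (reference_measure eps L).
Local Notation W eta := (fun phi : config R L => expR (log_weight V eta phi)).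

Let m := sigma_finite_pack (tuple_product_sigma_finite (single_site eps) #|` L|).

(** The integrand is jointly measurable but signed, so Tonelli is applied to its positive and
    negative parts separately. *)
Lemma measurable_integral_weight (f : config R L -> R) : measurable_fun setT f ->
  measurable_fun [set: Z] (fun z => \int[ref]_phi (f phi * W (eta z) phi)).
Proof.
move=> mf.
have mF : measurable_fun [set: Z * config R L]
    (fun zp => (f zp.2 * W (eta zp.1) zp.2)%:E).
  apply/measurable_EFinP; apply: measurable_funM.
    exact: measurableT_comp.
  apply: measurableT_comp => //.
  apply: (@measurable_log_weight _ _ _ hV L _ _ (fun zp : Z * config R L => eta zp.1) snd) => //.
  by move=> j; exact: (measurableT_comp (meta j) measurable_fst).
rewrite /Rintegral; apply: (@measurableT_comp _ _ _ _ _ _ (@fine R)) => //.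
under eq_fun do rewrite integralE.
pose F (zp : Z * config R L) := (f zp.2 * W (eta zp.1) zp.2)%:E.
apply: emeasurable_funB.
  rewrite (_ : (fun z => _) = fubini_F m (F^\+)%E).
    by apply: measurable_fun_fubini_tonelli_F => //; exact: measurable_funepos.
  by apply/funext => z; apply: eq_integral => phi _; rewrite !funeposE.
rewrite (_ : (fun z => _) = fubini_F m (F^\-)%E).
  by apply: measurable_fun_fubini_tonelli_F => //; exact: measurable_funeneg.
by apply/funext => z; apply: eq_integral => phi _; rewrite !funenegE.
Qed.

Lemma measurable_gibbs_mean (f : config R L -> R) : measurable_fun setT f ->
  (forall e, ref.-integrable setT (fun phi => (f phi * W e phi)%:E)) ->
  measurable_fun [set: Z] (fun z => gibbs_mean V eps (eta z) f).
Proof.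
move=> mf fW; under eq_fun do rewrite (gibbs_meanE hV mf (fW _)).
apply: measurable_funM; first exact: measurable_integral_weight.
(* The inverse is written as [expR (- ln Z)], valid because [Z] is positive, to make it a
   composition of measurable maps. *)
rewrite (_ : (fun z => _) = fun z => expR (- ln (\int[ref]_phi W (eta z) phi))).
  apply: measurableT_comp => //; apply: measurableT_comp => //.
  apply: (measurableT_comp (@measurable_ln R)).
  have := measurable_integral_weight (f := fun=> 1) (measurable_cst _).
  by under eq_fun do under eq_Rintegral do rewrite mul1r.
by apply/funext => z; rewrite expRN lnK// posrE; exact: partition_function_gt0.
Qed.

End measurability.

(** * Limits inferior and normal laws *)

Lemma limn_einfZl (R : realType) (c : R) (u : (\bar R)^nat) : 0 < c ->
  limn_einf (fun n => c%:E * u n)%E = (c%:E * limn_einf u)%E.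
Proof.
move=> c0; rewrite !limn_einf_lim -limeMl//; last exact: is_cvg_einfs.
congr (lim (_ @ \oo)); apply/funext => n; rewrite /einfs/=.
rewrite -ereal_inf_pZl//; congr ereal_inf.
by apply/seteqP; split => [_ [k nk <-]|_ [_ [k nk <-] <-]]; [exists (u k) => //; exists k|exists k].
Qed.

Section normal_law.
Context (R : realType) (s : R) (s0 : 0 < s).

Lemma normal_prob_symmetric : symmetric_law (normal_prob 0 s).
Proof.
move=> A mA; rewrite /normal_prob.
have mN : measurable_fun [set: R] (-%R : R -> measurableTypeR R) by [].
have mp : measurable_fun [set: R] (normal_pdf 0 s) := measurable_normal_pdf 0 s.
rewrite [RHS](@eq_measure_integral _ _ _ _
  (pushforward lebesgue_measure (-%R : _ -> measurableTypeR R))); last first.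
  by move=> B mB _; exact/esym/lebesgue_measureN.
rewrite ge0_integral_pushforward//; last 2 first.
- exact/measurable_funTS/measurable_EFinP.
- by move=> x _; rewrite lee_fin normal_pdf_ge0.
by apply: eq_integral => x _ /=; rewrite !normal_pdf_exp// sqrrN.
Qed.

(** Integration by parts for the identity, whose derivative is the constant 1. *)
Lemma normal_second_moment :
  (\int[normal_prob 0%R s]_x ((x ^+ 2)%R)%:E = (s ^+ 2)%:E)%E.
Proof.
have := @gaussian_integration_by_parts R s s0 id (fun=> 1) 1.
rewrite (_ : (\int[_]_x 1%:E = 1)%E); last first.
  by rewrite integral_cst//= mul1e probability_setT.
rewrite mule1 => <-//.
- by move=> x; exact: cst_continuous.
- by move=> x; rewrite mul1r; apply: le_trans (expR_ge1Dx _); rewrite lerDr.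
Qed.

Lemma integrable_exp_norm_normal b :
  (normal_prob 0 s).-integrable [set: R] (fun x : R => (expR (b * `|x|))%:E).
Proof.
apply: (@integrable_normal_prob R s s0 _ 1 b).
  by apply: measurableT_comp => //; apply: measurable_funM => //; apply: measurableT_comp.
by move=> x; rewrite mul1r ger0_norm ?expR_ge0.
Qed.

End normal_law.

(** The sum is at most its length times the largest term. Integrability of the exponential of a sum
    of fields is thereby reduced to the marginal laws, without a product formula for
    expectations. *)
Lemma expR_sum_le (R : realType) (I : eqType) (r : seq I) (a : I -> R) :
  r != [::] -> (forall i, 0 <= a i) ->
  expR (\sum_(i <- r) a i) <= \sum_(i <- r) expR ((size r)%:R * a i).
Proof.
move=> r0 a0.
have [i ir imax] : exists2 i, i \in r & forall j, j \in r -> a j <= a i.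
  elim: r r0 => // j r ih _; case: (eqVneq r [::]) => [->|/ih[i ir imax]].
    by exists j; rewrite ?mem_head// => k; rewrite mem_seq1 => /eqP ->.
  have [ij|ji] := leP (a i) (a j).
    exists j; rewrite ?mem_head// => k; rewrite inE => /predU1P[->//|kr].
    exact: le_trans (imax _ kr) ij.
  exists i; rewrite ?inE ?ir ?orbT// => k; rewrite inE => /predU1P[->|]; first exact: ltW.
  exact: imax.
apply: (@le_trans _ _ (expR ((size r)%:R * a i))).
  rewrite ler_expR mulr_natl -(count_predT r) -iter_addr_0 -big_const_seq.
  by rewrite !big_seq; apply: ler_sum.
rewrite [leRHS](perm_big _ (perm_to_rem ir)) big_cons lerDl.
by apply: sumr_ge0 => *; exact: expR_ge0.
Qed.

(** * Overlap and variance *)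

Section overlap.
Context (R : realType) (d : nat) (V : R -> R) (hV : admissible_potential V) (eps : {nonneg R}).
Local Notation site := 'rV[int]_d.+1.
Context (dT : measure_display) (T : measurableType dT) (P : probability T R)
  (eta : site -> {RV P >-> R}) (s : R) (s0 : 0 < s)
  (heta : iid eta (normal_prob 0 s)).
Variable L : {fset site}.
Implicit Types (i j : site).

(* [R] and [measurableTypeR R] have the same measurable sets but different
   displays; [lebesgue_measure] and [config] use the latter. *)
Definition field_rv j : T -> measurableTypeR R := eta j.

Lemma measurable_field_rv j : measurable_fun [set: T] (field_rv j).
Proof. by move=> mT B mB; rewrite setTI; exact: (measurable_funPTI (eta j) mB). Qed.

HB.instance Definition _ j :=
  isMeasurableFun.Build _ _ _ _ (field_rv j) (measurable_field_rv j).

Lemma integral_field (g : R -> \bar R) j :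
  (\int[distribution P (field_rv j)]_x g x = \int[normal_prob 0%R s]_x g x)%E.
Proof.
by apply: eq_measure_integral => A mA _; exact: heta.2.
Qed.

Lemma eq_log_weight (e1 e2 : site -> R) : (forall j, j \in L -> e1 j = e2 j) ->
  log_weight V (L := L) e1 = log_weight V e2.
Proof.
move=> e12; apply/funext => phi; rewrite /log_weight; congr (_ + _).
by rewrite big_seq [RHS]big_seq; apply: eq_bigr => j jL; rewrite e12.
Qed.

Lemma eq_gibbs (e1 e2 : site -> R) : (forall j, j \in L -> e1 j = e2 j) ->
  gibbs V eps (L := L) e1 = gibbs V eps e2.
Proof.
move=> /eq_log_weight e12; apply/funext => A.
by rewrite /gibbs /partition_function e12.
Qed.

Section site.
Variables (i : site) (iL : i \in L).
Local Notation L' := (L `\ i)%fset.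
Local Notation n := (#|` L'|).

(** Fields are stored in the tuple type of heights, so that [height] reads them back and the results
    on tuples apply to them. *)
Definition other_fields (w : T) : config R L' :=
  [tuple eta (nth 0 (enum_fset L') k) w | k < n].

Lemma measurable_other_fields : measurable_fun [set: T] other_fields.
Proof.
apply/measurable_fun_tnthP => k.
rewrite (_ : _ \o _ = field_rv (nth 0 (enum_fset L') k)).
  exact: measurable_field_rv.
by apply/funext => w /=; rewrite tnth_mktuple.
Qed.

HB.instance Definition _ := isMeasurableFun.Build _ _ _ _ other_fields measurable_other_fields.

Lemma height_other_fields w j : j \in L' -> height (other_fields w) j = eta j w.
Proof.
move=> jL; have jn : (index j (enum_fset L') < n)%N by rewrite index_mem.
by rewrite /height -[index _ _]/(nat_of_ord (Ordinal jn)) -tnth_nth tnth_mktuple/= nth_index.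
Qed.

Lemma set_field_other_fields w j : j \in L ->
  set_field (height (other_fields w)) i (eta i w) j = eta j w.
Proof.
move=> jL; rewrite /set_field; case: eqP => [->//|/eqP ji].
by rewrite height_other_fields// !inE ji.
Qed.

Lemma other_fields_indep A B : measurable A -> (forall k, measurable (B k)) ->
  P (eta i @^-1` A `&` other_fields @^-1` tuple_box B) =
  (P (eta i @^-1` A) * P (other_fields @^-1` tuple_box B))%E.
Proof.
move=> mA mB; have [indep _] := heta.
(* The sides of the box, moved from tuple positions to sites. Both events become finite
   intersections over sites, and the product formula is used on [L] and on [L']. *)
pose C j : set R := if insub (index j (enum_fset L')) is Some k then B k else setT.
have mC j : measurable (C j) by rewrite /C; case: insub.
have boxE : other_fields @^-1` tuple_box B = \bigcap_(j in [set` L']) (eta j @^-1` C j).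
  apply/seteqP; split => w /=.
    move=> Bw j /= jL.
    have jn : (index j (enum_fset L') < n)%N by rewrite index_mem.
    have := Bw (Ordinal jn); rewrite tnth_mktuple/= nth_index//.
    by rewrite /C insubT.
  move=> Cw k; rewrite tnth_mktuple.
  have kL : nth 0 (enum_fset L') k \in L' by exact: mem_nth.
  have := Cw _ kL; rewrite /C /= index_uniq ?fset_uniq//.
  by rewrite valK.
pose C' j := if j == i then A else C j.
have mC' j : measurable (C' j) by rewrite /C'; case: ifP.
have C'C j : j \in L' -> C' j = C j by rewrite !inE /C' => /andP[/negbTE ->].
have -> : eta i @^-1` A `&` other_fields @^-1` tuple_box B =
    \bigcap_(j in [set` L]) (eta j @^-1` C' j).
  rewrite boxE; apply/seteqP; split => w /=.
    move=> [Aw Cw] j /= jL; rewrite /C'; case: eqP => [->//|/eqP ji].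
    by apply: Cw => /=; rewrite !inE ji.
  move=> Cw; split; first by have := Cw i iL; rewrite /C' eqxx.
  by move=> j /= jL; rewrite -C'C//; apply: Cw => /=; move: jL; rewrite !inE => /andP[].
rewrite indep// boxE indep// (big_fsetD1 i)//= /C' eqxx; congr (_ * _)%E.
by rewrite big_seq [RHS]big_seq; apply: eq_bigr => j jL; rewrite -[if _ then _ else _]/(C' j) C'C.
Qed.

Let f (y : config R L') (x : R) := mean_height V eps L (set_field (height y) i x) i.
Let v (y : config R L') (x : R) := var_height V eps L (set_field (height y) i x) i.

Lemma mean_height_other_fields w :
  mean_height V eps L (eta ^~ w) i = f (other_fields w) (eta i w).
Proof.
rewrite /f /mean_height /gibbs_mean.
by rewrite (eq_gibbs (set_field_other_fields w)).
Qed.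

Lemma var_height_other_fields w :
  var_height V eps L (eta ^~ w) i = v (other_fields w) (eta i w).
Proof.
rewrite /v /var_height /mean_height /gibbs_mean.
by rewrite (eq_gibbs (set_field_other_fields w)).
Qed.

Let measurable_set_field j : measurable_fun [set: measurableTypeR R * config R L']
  (fun z => set_field (height z.2) i z.1 j).
Proof.
rewrite /set_field; case: eqP => _.
  have mfst : measurable_fun [set: measurableTypeR R * config R L']
    (@fst (measurableTypeR R) (config R L')) by exact: measurable_fst.
  by move=> mT B mB; exact: (mfst mT B mB).
exact: (measurableT_comp (measurable_height j) measurable_snd).
Qed.

Let measurable_mean : measurable_fun [set: measurableTypeR R * config R L'] (fun z => f z.2 z.1).
Proof.
apply: (measurable_gibbs_mean hV (eps := eps) measurable_set_field).
  exact: measurable_height.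
move=> e; apply: (integrable_mul_weight hV eps e (C := 1) (B := 1)) => //.
  exact: measurable_height.
move=> phi; rewrite !mul1r (le_trans (height_le_sum i phi))//.
exact: sum_norm_le_expR.
Qed.

Let measurable_var : measurable_fun [set: measurableTypeR R * config R L'] (fun z => v z.2 z.1).
Proof.
apply: measurable_funB; last by apply: measurable_funX; exact: measurable_mean.
apply: (measurable_gibbs_mean hV (eps := eps) measurable_set_field).
  by apply: measurable_funX; exact: measurable_height.
move=> e; apply: (integrable_mul_weight hV eps e (C := 1) (B := 2)) => //.
  by apply: measurable_funX; exact: measurable_height.
move=> phi; rewrite mul1r; apply: le_trans (ler_expr_expR _ 2) _.
by rewrite ler_expR ler_wpM2l// height_le_sum.
Qed.

(** By [mean_height_growth] the overlap is at most a constant times [|eta_i| expR H <= expR (2 H)],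
    and [expR_sum_le] splits this into exponentials of single normal fields. This discharges the
    integrability premise of [overlap_constant]. *)
Lemma integrable_overlap :
  P.-integrable [set: T] (EFin \o (fun w => eta i w * mean_height V eps L (eta ^~ w) i)).
Proof.
have [C [C0 growth]] := mean_height_growth hV eps L i.
pose N : R := (size (enum_fset L))%:R.
have iE j : P.-integrable [set: T] (fun w => (expR (N * (2 * `|eta j w|)))%:E).
  apply/integrableP; split.
    apply/measurable_EFinP; apply: measurableT_comp => //.
    by apply: measurable_funM => //; apply: measurable_funM => //; apply: measurableT_comp.
  have : (\int[distribution P (field_rv j)]_x (expR (N * (2 * `|x|)))%:E < +oo)%E.
    rewrite (integral_field).
    have := integrable_exp_norm_normal s0 (N * 2) => /integrableP[_].
    by under eq_integral do rewrite gee0_abs ?lee_fin ?expR_ge0// -mulrA.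
  rewrite ge0_integral_distribution//.
    by under [X in (X < _)%E -> _]eq_integral do rewrite -[(_ \o _) _]gee0_abs ?lee_fin ?expR_ge0//.
  apply/measurable_EFinP; apply: measurableT_comp => //.
  by apply: measurable_funM => //; apply: measurable_funM => //; apply: measurableT_comp.
apply: (@le_integrable _ _ _ P _ measurableT _
    (fun w => C%:E * (\sum_(j <- L) (expR (N * (2 * `|eta j w|)))%:E))%E).
- apply/measurable_EFinP; apply: measurable_funM; first exact: measurable_funP.
  under eq_fun do rewrite mean_height_other_fields.
  have mXY : measurable_fun [set: T] (fun w => (field_rv i w, other_fields w)).
    by apply: measurable_fun_pair; [exact: measurable_field_rv|exact: measurable_other_fields].
  exact: (measurableT_comp measurable_mean mXY).
- move=> w _; rewrite sumEFin -EFinM /= lee_fin; apply: le_trans (ler_norm _).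
  have L0 : enum_fset L != [::].
    by apply: contraTneq iL => L0; rewrite -[i \in L]/(i \in enum_fset L) L0.
  have a0 j : 0 <= 2 * `|eta j w| by rewrite mulr_ge0.
  apply: le_trans (ler_wpM2l C0 (expR_sum_le L0 a0)).
  rewrite normrM -mulr_sumr mulr_natl mulr2n expRD mulrCA.
  rewrite ler_pM//.
  apply: le_trans (expR_ge1Dx _); rewrite (big_fsetD1 i)//= addrCA lerDl.
  by rewrite addr_ge0// sumr_ge0.
- by apply: integrableZl => //; apply: integrable_sum.
Qed.

(** With the other fields frozen, the inner integral over [eta_i] is one-dimensional Gaussian
    integration by parts for the mean height, whose derivative is the variance. *)
Lemma expectation_overlap :
  ('E_P[fun w => (eta i w * mean_height V eps L (eta ^~ w) i)%R] =
   (s ^+ 2)%:E * 'E_P[fun w => var_height V eps L (eta ^~ w) i])%E.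
Proof.
rewrite unlock.
have mxf : measurable_fun [set: measurableTypeR R * config R L'] (fun z => (z.1 * f z.2 z.1)%:E).
  by apply/measurable_EFinP; apply: measurable_funM.
have mv : measurable_fun [set: measurableTypeR R * config R L'] (fun z => (v z.2 z.1)%:E).
  exact/measurable_EFinP.
have ixf : P.-integrable [set: T] (fun w => (eta i w * f (other_fields w) (eta i w))%:E).
  rewrite [X in P.-integrable _ X](_ : _ =
      EFin \o (fun w => eta i w * mean_height V eps L (eta ^~ w) i)).
    exact: integrable_overlap.
  by apply/funext => w; rewrite /comp mean_height_other_fields.
have indep : forall A B, measurable A -> (forall k, measurable (B k)) ->
   P (field_rv i @^-1` A `&` other_fields @^-1` tuple_box B) =
   (P (field_rv i @^-1` A) * P (other_fields @^-1` tuple_box B))%E := other_fields_indep.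
under eq_integral do rewrite mean_height_other_fields.
under [in RHS]eq_integral do rewrite var_height_other_fields.
rewrite (integral_indep indep mxf ixf).
have v0 z : (0 <= (v z.2 z.1)%:E)%E by rewrite lee_fin var_height_set_field_ge0.
rewrite (ge0_integral_indep indep mv v0) -ge0_integralZl//=.
- apply: eq_integral => y _; rewrite !integral_field.
  have [C [C0 growth]] := mean_height_growth hV eps L i.
  pose H' := \sum_(j <- L') `|height y j|.
  apply: (@gaussian_integration_by_parts R s s0 (f y) (v y) (C * expR H')).
  + by move=> x; exact: is_derive_mean_height.
  + exact: continuous_var_height.
  + by move=> x; exact: var_height_set_field_ge0.
  + move=> x; apply: le_trans (growth _) _; rewrite -mulrA ler_wpM2l// -expRD ler_expR.
    rewrite (big_fsetD1 i)//= /set_field eqxx addrC lerD2r.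
    rewrite /H' big_seq [leRHS]big_seq; apply: ler_sum => j.
    by rewrite !inE => /andP[/negbTE ->].
- exact: (@measurable_fun_fubini_tonelli_G _ _ _ _ _ (distribution P (field_rv i)) _ mv v0).
- by move=> y _; apply: integral_ge0 => x _; exact: (v0 (x, y)).
- exact: sqr_ge0.
Qed.

End site.

End overlap.

Unset Implicit Arguments.

Theorem corollary1p2 (R : realType) (V : R -> R) (a : R)
  (hV : admissible_potential V) (ha : overlap_constant V a)
  (dT : measure_display) (T : measurableType dT) (P : probability T R)
  (eta : 'rV[int]_2 -> {RV P >-> R}) (sigma : R) (hsigma : 0 < sigma)
  (heta : iid eta (normal_prob 0 sigma)) (eps : {nonneg R}) :
  (a%:E <= limn_einf (fun L => (log_rate R L)%:E *
     \sum_(i <- box 2 L) 'E_P[fun w => var_height V eps (box 2 L) (eta ^~ w) i]))%E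
  /\ 0 < a.
Proof.
have [a0 overlap] := ha; split => //.
have second_moment : ('E_P[fun w => (eta 0%R w ^+ 2)%R] = (sigma ^+ 2)%:E)%E.
  rewrite unlock -(normal_second_moment hsigma) -(integral_field heta _ 0).
  rewrite ge0_integral_distribution//; last first.
    by move=> x; rewrite lee_fin sqr_ge0.
  by apply/measurable_EFinP; exact: measurable_funX.
have s2 : 0 < sigma ^+ 2 by rewrite exprn_gt0.
have := overlap dT T P eta (normal_prob 0 sigma) eps heta (normal_prob_symmetric hsigma).
rewrite second_moment ltry => /(_ isT).
have int L i : i \in box 2 L -> P.-integrable [set: T]
    (EFin \o (fun w => eta i w * mean_height V eps (box 2 L) (eta ^~ w) i)).
  by move=> iL; exact: (integrable_overlap hV eps hsigma heta iL).
move=> /(_ int) H.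
rewrite -(@lee_pmul2l _ (sigma ^+ 2)%:E)//.
rewrite -limn_einfZl// muleC; apply: le_trans H _.
(* After multiplication by [sigma^2] the variance sequence and the overlap sequence coincide for
   every [L], so nothing is lost in the lower limit. *)
rewrite le_eqVlt; apply/orP; left; apply/eqP; congr limn_einf; apply/funext => L.
rewrite muleCA; congr (_ * _)%E.
rewrite big_seq [in RHS]big_seq ge0_sume_distrr => [|i iL]; last first.
  by apply: expectation_ge0 => w; exact: var_height_ge0.
by apply: eq_bigr => i iL; exact: expectation_overlap.
Qed.
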